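(* Let $G$ be a (real) Lie group equipped with a bi-invariant pseudo-Riemannian metric, and let $n=\dim G$. Then for every pair of non-negative integers $(r,s)$ with $r+s=n$, there exists a geodesically complete left-invariant pseudo-Riemannian metric on $G$ of signature $(r,s)$.
   Context: Signature $(r,s)$ means $r$ positive and $s$ negative directions; definite metrics are included. A pseudo-Riemannian metric is geodesically complete if every maximal geodesic of its Levi-Civita connection is defined on all of $\mathbb{R}$. A metric on $G$ is left-invariant (bi-invariant) if all left translations (all left and right translations) are isometries. *)

(* Defs.v *)
From HB Require Import structures.
From mathcomp Require Import all_boot all_order all_algebra.
From mathcomp Require Import all_classical all_reals all_analysis.
From mathcomp Require Import ring.

Set Implicit Arguments.
Unset Strict Implicit.
Unset Printing Implicit Defensive.

Import Order.TTheory GRing.Theory Num.Theory.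
Import numFieldNormedType.Exports.

Local Open Scope classical_set_scope.
Local Open Scope ring_scope.

(* [Ck_on k U f] and [smooth_on U f] are meant for [U] open and [V] finite
   dimensional: [f] is then of class C^(k+1) on [U] iff it is differentiable on
   [U] and all its directional derivatives are of class C^k on [U]. *)
Fixpoint Ck_on (R : realType) (V W : normedModType R) (k : nat)
    (U : set V) (f : V -> W) : Prop :=
  match k with
  | 0 => forall x, U x -> {for x, continuous f}
  | k'.+1 => (forall x, U x -> differentiable f x) /\
             (forall v, Ck_on k' U ('D_v f))
  end.

Definition smooth_on (R : realType) (V W : normedModType R)
    (U : set V) (f : V -> W) : Prop := forall k, Ck_on k U f.

(* The values of [cfwd] outside [cdom] and of [cbwd] outside [cimg] are
   irrelevant. *)
Record chart (R : realType) (n : nat) (M : topologicalType) := Chart {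
  cdom : set M;
  cimg : set 'rV[R]_n;
  cfwd : M -> 'rV[R]_n;
  cbwd : 'rV[R]_n -> M;
  open_cdom : open cdom;
  open_cimg : open cimg;
  cfwd_img : forall p, cdom p -> cimg (cfwd p);
  cbwd_dom : forall x, cimg x -> cdom (cbwd x);
  cfwdK : forall p, cdom p -> cbwd (cfwd p) = p;
  cbwdK : forall x, cimg x -> cfwd (cbwd x) = x;
  cfwd_continuous : forall p, cdom p -> {for p, continuous cfwd};
  cbwd_continuous : forall x, cimg x -> {for x, continuous cbwd} }.

(* The atlas need not be maximal. *)
HB.mixin Record isSmoothManifold (R : realType) (n : nat) M
    of Topological M := {
  atlas : set (chart R n M);
  manifold_hausdorff : hausdorff_space M;
  manifold_second_countable : @second_countable M;
  atlas_cover : forall p : M, exists2 c, atlas c & cdom c p;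
  atlas_compatible : forall c d, atlas c -> atlas d ->
    smooth_on (cimg c `&` cbwd c @^-1` cdom d) (cfwd d \o cbwd c) }.

#[short(type="smoothManifoldType")]
HB.structure Definition SmoothManifold (R : realType) (n : nat) :=
  { M of isSmoothManifold R n M & Topological M }.

Arguments atlas {R n s}.

Definition smooth_map (R : realType) (m n : nat)
    (M : smoothManifoldType R m) (N : smoothManifoldType R n)
    (F : M -> N) : Prop :=
  continuous F /\
  forall (c : chart R m M) (d : chart R n N), atlas c -> atlas d ->
    smooth_on (cimg c `&` (F \o cbwd c) @^-1` cdom d) (cfwd d \o F \o cbwd c).

Definition diffeomorphism (R : realType) (m n : nat)
    (M : smoothManifoldType R m) (N : smoothManifoldType R n)
    (F : M -> N) : Prop :=
  smooth_map F /\
  exists F' : N -> M, [/\ smooth_map F', cancel F F' & cancel F' F].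

(* Smoothness of the multiplication G * G -> G is expressed in the product
   charts of the product manifold G * G. *)
HB.mixin Record isLieGroup (R : realType) (n : nat) G
    of SmoothManifold R n G & Group G := {
  mulg_continuous : continuous (fun xy : G * G => (xy.1 * xy.2)%g);
  mulg_smooth : forall c d e : chart R n G, atlas c -> atlas d -> atlas e ->
    smooth_on
      [set uv : 'rV[R]_n * 'rV[R]_n | [/\ cimg c uv.1, cimg d uv.2 &
        cdom e (cbwd c uv.1 * cbwd d uv.2)%g]]
      (fun uv => cfwd e (cbwd c uv.1 * cbwd d uv.2)%g);
  invg_smooth : smooth_map (fun x : G => (x^-1)%g) }.

#[short(type="lieGroupType")]
HB.structure Definition LieGroup (R : realType) (n : nat) :=
  { G of isLieGroup R n G & SmoothManifold R n G & Group G }.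

(* A metric is given by its component matrices [gmx c p] at [p] in the charts
   [c]: two tangent vectors at [p] with coordinate rows [u] and [v] in [c] have
   scalar product [u *m gmx c p *m v^T].  With row vectors, a change of charts
   sends [u] to [u *m 'J (cfwd d \o cbwd c) (cfwd c p)], whence
   [gmx_change]. *)
Record pseudo_metric (R : realType) (n : nat) (M : smoothManifoldType R n) :=
  PseudoMetric {
  gmx : chart R n M -> M -> 'M[R]_n;
  gmx_sym : forall c p, atlas c -> cdom c p -> (gmx c p)^T = gmx c p;
  gmx_nondegenerate : forall c p, atlas c -> cdom c p -> gmx c p \in unitmx;
  gmx_smooth : forall c, atlas c -> smooth_on (cimg c) (gmx c \o cbwd c);
  gmx_change : forall c d p, atlas c -> atlas d -> cdom c p -> cdom d p ->
    let J := 'J (cfwd d \o cbwd c) (cfwd c p) in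
    gmx c p = J *m gmx d p *m J^T }.

(* The rows of [P] are an orthonormal basis with [r] vectors of square 1 and [s]
   vectors of square -1. *)
Definition mx_signature (R : realType) (n : nat) (A : 'M[R]_n) (r s : nat) :
    Prop :=
  (r + s = n)%N /\
  exists2 P : 'M[R]_n, P \in unitmx &
    P *m A *m P^T = diag_mx (\row_(i < n) (if (i < r)%N then 1 else -1)).

Section Metric.
Variables (R : realType) (n : nat) (M : smoothManifoldType R n).
Implicit Types (g : pseudo_metric M) (c d : chart R n M).

Definition metric_signature g (r s : nat) : Prop :=
  forall c p, atlas c -> cdom c p -> mx_signature (gmx g c p) r s.

Definition metric_isometry g (F : M -> M) : Prop :=
  diffeomorphism F /\
  forall c d p, atlas c -> atlas d -> cdom c p -> cdom d (F p) ->
    let J := 'J (cfwd d \o F \o cbwd c) (cfwd c p) in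
    gmx g c p = J *m gmx g d (F p) *m J^T.

Definition partial (i : 'I_n) (f : 'rV[R]_n -> R) : 'rV[R]_n -> R :=
  'D_(delta_mx 0 i) f.

Definition gcoord g c (i j : 'I_n) (x : 'rV[R]_n) : R := gmx g c (cbwd c x) i j.

(* The coefficients of the Levi-Civita connection in the chart [c]:
   [christoffel g c i j k] is the component on d/dx_k of the covariant derivative
   of d/dx_j along d/dx_i, as determined by [christoffel_torsion_free] and
   [christoffel_compatible] below. *)
Definition christoffel g c (i j k : 'I_n) (x : 'rV[R]_n) : R :=
  2^-1 * \sum_(l < n) invmx (gmx g c (cbwd c x)) k l *
    (partial i (gcoord g c j l) x + partial j (gcoord g c i l) x
     - partial l (gcoord g c i j) x).

Let gcoordC g c i j x : atlas c -> cimg c x -> gcoord g c i j x = gcoord g c j i x.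
Proof.
by move=> ac xc; rewrite /gcoord -{1}(gmx_sym g ac (cbwd_dom xc)) mxE.
Qed.

Let partial_gcoordC g c l i j x : atlas c -> cimg c x ->
  partial l (gcoord g c i j) x = partial l (gcoord g c j i) x.
Proof.
move=> ac xc; apply: near_eq_derive.
near=> y; apply: gcoordC => //; near: y.
by apply: open_nbhs_nbhs; split=> //; exact: open_cimg.
Unshelve. all: by end_near. Qed.

Lemma christoffel_torsion_free g c i j k x : atlas c -> cimg c x ->
  christoffel g c i j k x = christoffel g c j i k x.
Proof.
move=> ac xc; congr (_ * _); apply: eq_bigr => l _; congr (_ * _).
by rewrite (partial_gcoordC g l i j ac xc) [X in X - _]addrC.
Qed.

Lemma christoffel_compatible g c i j k x : atlas c -> cimg c x ->
  partial k (gcoord g c i j) x =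
  \sum_(l < n) (christoffel g c k i l x * gcoord g c l j x +
                christoffel g c k j l x * gcoord g c i l x).
Proof.
move=> ac xc.
have low a b e : \sum_(l < n) christoffel g c a b l x * gcoord g c l e x =
    2^-1 * (partial a (gcoord g c b e) x + partial b (gcoord g c a e) x
            - partial e (gcoord g c a b) x).
  under eq_bigr do rewrite gcoordC// -mulrA mulr_suml.
  rewrite -mulr_sumr exchange_big/=; congr (_ * _).
  rewrite (bigD1 e)//= [X in _ + X]big1 ?addr0 => [|m me].
    under eq_bigr do rewrite mulrAC mulrC [X in _ * X]mulrC.
    rewrite -mulr_sumr.
    have /matrixP/(_ e e) := mulmxV (gmx_nondegenerate g ac (cbwd_dom xc)).
    by rewrite !mxE eqxx => ->; rewrite mulr1.
  under eq_bigr do rewrite mulrAC mulrC [X in _ * X]mulrC.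
  rewrite -mulr_sumr.
  have /matrixP/(_ e m) := mulmxV (gmx_nondegenerate g ac (cbwd_dom xc)).
  by rewrite !mxE eq_sym (negbTE me) => ->; rewrite mulr0.
rewrite big_split/= low.
under [X in _ + X]eq_bigr do rewrite gcoordC//.
by rewrite low (partial_gcoordC g k j i ac xc); field.
Qed.

Definition geodesic g (I : set R) (gamma : R -> M) : Prop :=
  [/\ open I, is_interval I, I !=set0,
      forall t, I t -> {for t, continuous gamma}
    & forall c, atlas c ->
      let x : R -> 'rV[R]_n := cfwd c \o gamma in
      smooth_on (I `&` gamma @^-1` cdom c : set R^o) (x : R^o -> 'rV[R]_n) /\
      forall t, I t -> cdom c (gamma t) -> forall k,
        derive1n 2 x t 0 k +
        \sum_(i < n) \sum_(j < n)
          christoffel g c i j k (x t) * derive1 x t 0 i * derive1 x t 0 j = 0].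

Definition maximal_geodesic g (I : set R) (gamma : R -> M) : Prop :=
  geodesic g I gamma /\
  forall J delta, geodesic g J delta -> I `<=` J ->
    (forall t, I t -> delta t = gamma t) -> J = I.

Definition geodesically_complete g : Prop :=
  forall I gamma, maximal_geodesic g I gamma -> I = setT.

End Metric.

Definition left_invariant (R : realType) (n : nat) (G : lieGroupType R n)
    (g : pseudo_metric G) : Prop :=
  forall a : G, metric_isometry g (fun x => (a * x)%g).

Definition right_invariant (R : realType) (n : nat) (G : lieGroupType R n)
    (g : pseudo_metric G) : Prop :=
  forall a : G, metric_isometry g (fun x => (x * a)%g).

Definition bi_invariant (R : realType) (n : nat) (G : lieGroupType R n)
    (g : pseudo_metric G) : Prop :=
  left_invariant g /\ right_invariant g.

(* Main.v *)
Require Import Defs.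
From mathcomp Require Import all_boot all_order all_algebra.
From mathcomp Require Import all_classical all_reals all_analysis.
From mathcomp Require Import perm ring lra.

(** A left-invariant metric [g] on [G] is given by its matrix [B] at the unit.
    Right-invariant vector fields generate left translations, so they are Killing
    fields of [g], and by Noether's theorem a curve is a geodesic iff its
    right-trivialised momentum [m] is constant.  Hence the geodesics are the integral
    curves of vector fields on [G] that depend linearly on [m].  If [v] is the
    left-trivialised velocity and [H] the matrix at the unit of the bi-invariant metric,
    then [v *m B] is the coadjoint transform of [m], so that both the energy
    [v *m B *m v^T] and [v *m B *m H^-1 *m B *m v^T] are conserved.  When [H] is
    [diag(-1, .., -1, 1, .., 1)] with [q] negative entries, there is a diagonal [B] of any
    prescribed signature [(r, s)] making [B *m H^-1 *m B + B] definite (positive if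
    [q <= r], negative otherwise).  The velocities [v] then stay bounded; since left
    translations are isometries, a geodesic can be continued for a time that does not
    depend on the point reached, and a maximal one is defined on the whole line. *)

Set Implicit Arguments.
Unset Strict Implicit.
Unset Printing Implicit Defensive.

Import Order.TTheory GRing.Theory Num.Theory.
Import numFieldNormedType.Exports.

Local Open Scope classical_set_scope.
Local Open Scope ring_scope.

(** * Calculus of [C^k] maps *)

(** Fixing the momentum removes the velocity from the unknowns: the flow lives on [G] instead of its
    tangent bundle, and first-order equations suffice, with no Lie bracket, exponential map or
    Euler-Arnold equation. The adjoint action enters only through the matrices [adm] of [h]-products
    between a right-invariant and a left-invariant frame. Bi-invariance of [h] says that both frames
    have the same Gram matrix [H0]; hence the adjoint action is orthogonal and
    [m *m invmx H0 *m m^T] is also a quadratic form in the left-trivialised velocity. Each of the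
    two conserved forms may be indefinite, and then neither confines the velocity alone. Their sum
    is not homogeneous in [B], so the size of the entries of [B], and not only their signs, can be
    used to make it definite. *)

Lemma near_eq_differentiable (R : realType) (V W : normedModType R)
    (f g : V -> W) (x : V) :
  (\near x, f x = g x) -> differentiable f x -> differentiable g x.
Proof.
move=> fg /[dup] df /diff_locallyP [cf Ef].
have key : g \o shift x = cst (g x) + 'd f x +o_ 0 id.
  apply/eqaddoP => _/posnumP[e].
  move/eqaddoP : Ef => /(_ e%:num)/(_ [gt0 of e%:num]).
  have fg0 : \forall y \near (0 : V), f (y + x) = g (y + x).
    have := near_shift 0 x (fun y => f y = g y); rewrite propeqE => -[+ _] => /(_ fg).
    by apply: filterS => y /=; rewrite subr0.
  move=> H; near=> y.
  have <- : (f \o shift x - (cst (f x) + 'd f x)) y = (g \o shift x - (cst (g x) + 'd f x)) y.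
    rewrite /= !fctE /= /cst; congr (_ - (_ + _)); first by near: y.
    exact: (nbhs_singleton fg).
  by near: y.
by apply/diff_locallyP; rewrite (diff_unique cf key).
Unshelve. all: by end_near. Qed.

Section Ck.
Variables (R : realType) (V : normedModType R).

Lemma open_near_eq (W : normedModType R) (U : set V) (f g : V -> W) x :
  open U -> U x -> {in U, f =1 g} -> \forall y \near x, f y = g y.
Proof.
move=> oU Ux fg.
have := open_nbhs_nbhs (conj oU Ux : open_nbhs x U).
by apply: filterS => y Uy; exact/fg/mem_set.
Qed.

(** Limits and derivatives at a point of [U] are those of the ambient space; openness turns
    agreement on [U] into agreement near each of its points. *)
Lemma Ck_on_eq (W : normedModType R) k (U : set V) (f g : V -> W) :
  open U -> {in U, f =1 g} -> Ck_on k U f -> Ck_on k U g.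
Proof.
move=> oU; elim: k f g => [|k IH] f g fg /=.
  move=> H x Ux; rewrite /prop_for /continuous_at -(fg _ (mem_set Ux)).
  apply: cvg_trans (H x Ux); apply: near_eq_cvg.
  exact: open_near_eq oU Ux fg.
move=> [H1 H2]; split=> [x Ux|v].
  by apply: near_eq_differentiable (H1 x Ux); exact: open_near_eq oU Ux fg.
apply: IH (H2 v) => x /set_mem Ux.
by apply: near_eq_derive; exact: open_near_eq oU Ux fg.
Qed.

Lemma Ck_onS (W : normedModType R) k (U : set V) (f : V -> W) :
  Ck_on k.+1 U f -> Ck_on k U f.
Proof.
elim: k f => [f [H _] x Ux|k IH f [H1 H2]]; first exact/differentiable_continuous/H.
by split=> // v; exact/IH/H2.
Qed.

Lemma smooth_on_differentiable (W : normedModType R) (U : set V) (f : V -> W) x :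
  smooth_on U f -> U x -> differentiable f x.
Proof. by move=> /(_ 1%N)[+ _]; exact. Qed.

Lemma smooth_on_derive (W : normedModType R) (U : set V) (f : V -> W) v :
  smooth_on U f -> smooth_on U ('D_v f).
Proof. by move=> H k; have [_] := H k.+1; exact. Qed.

Lemma Ck_on_cst (W : normedModType R) k (U : set V) (w : W) :
  Ck_on k U (cst w : V -> W).
Proof.
elim: k w => [w x _|k IH w]; first exact: cst_continuous.
split=> [x _|v]; first exact: differentiable_cst.
suff -> : 'D_v (cst w : V -> W) = cst 0 by exact: IH.
by apply/funext => x; rewrite derive_cst.
Qed.

Lemma Ck_onD (W : normedModType R) k (U : set V) (f g : V -> W) :
  open U -> Ck_on k U f -> Ck_on k U g -> Ck_on k U (fun x => f x + g x).
Proof.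
move=> oU; elim: k f g => [f g Hf Hg x Ux|k IH f g [Hf1 Hf2] [Hg1 Hg2]].
  by apply: continuousD; [exact: Hf|exact: Hg].
split=> [x Ux|v]; first by apply: differentiableD; [exact: Hf1|exact: Hg1].
apply: Ck_on_eq (IH _ _ (Hf2 v) (Hg2 v)) => // x /set_mem Ux.
by rewrite -[RHS]/('D_v (f + g) x) deriveD//; apply: diff_derivable; auto.
Qed.

Lemma Ck_onM k (U : set V) (f g : V -> R) :
  open U -> Ck_on k U f -> Ck_on k U g -> Ck_on k U (fun x => f x * g x).
Proof.
move=> oU; elim: k f g => [f g Hf Hg x Ux|k IH f g].
  by apply: continuousM; [exact: Hf|exact: Hg].
move=> Hf Hg; have [Hf1 Hf2] := Hf; have [Hg1 Hg2] := Hg.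
split=> [x Ux|v]; first by apply: differentiableM; [exact: Hf1|exact: Hg1].
have := Ck_onD oU (IH _ _ (Ck_onS Hf) (Hg2 v)) (IH _ _ (Ck_onS Hg) (Hf2 v)).
apply: Ck_on_eq => // x /set_mem Ux.
by rewrite -[RHS]/('D_v (f * g) x) deriveM//; apply: diff_derivable; auto.
Qed.

Lemma Ck_on_sum k (U : set V) (W : normedModType R) (I : Type) (r : seq I)
    (F : I -> V -> W) :
  open U -> (forall i, Ck_on k U (F i)) -> Ck_on k U (fun x => \sum_(i <- r) F i x).
Proof.
move=> oU HF; elim: r => [|i r IH].
  apply: Ck_on_eq (Ck_on_cst k U 0) => // x _; by rewrite big_nil.
apply: Ck_on_eq (Ck_onD oU (HF i) IH) => // x _; by rewrite big_cons.
Qed.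

Lemma differentiable_mxP m n (F : V -> 'M[R]_(m, n)) x :
  differentiable F x <-> forall i j, differentiable (fun y => F y i j : R) x.
Proof.
split=> [H i j|H].
  exact: (differentiable_comp H (differentiable_coord (F x) i j)).
have -> : F = (fun y => \sum_i \sum_j F y i j *: delta_mx i j).
  by apply/funext => y; exact: matrix_sum_delta.
have -> : (fun y => \sum_i \sum_j F y i j *: delta_mx i j) =
   \sum_i \sum_j (fun y => F y i j *: delta_mx i j).
  by apply/funext => y; rewrite fct_sumE; apply: eq_bigr => i _; rewrite fct_sumE.
do 2 apply: differentiable_sum => ?; exact: differentiableZl.
Qed.

Lemma continuous_mxP m n (F : V -> 'M[R]_(m, n)) x :
  {for x, continuous F} <-> forall i j, {for x, continuous (fun y => F y i j : R)}.
Proof.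
split=> [H i j|H].
  exact: (continuous_comp H (@coord_continuous _ _ _ i j (F x))).
apply/cvgrPdist_le => /= e e0; near=> y.
rewrite /Num.Def.normr/= mx_normrE (bigmax_le _ (ltW e0))//= => -[i j] _.
rewrite !mxE/=; move: i j; near: y.
apply: filter_forall => i; apply: filter_forall => j.
exact: ((cvgrPdist_le _ _).1 (H i j)).
Unshelve. all: by end_near. Qed.

Lemma Ck_on_mxP k (U : set V) m n (F : V -> 'M[R]_(m, n)) :
  open U ->
  Ck_on k U F <-> forall i j, Ck_on k U (fun y => F y i j : R).
Proof.
move=> oU; elim: k F => [F|k IH F].
  split=> [H i j x Ux|H x Ux]; first exact: ((continuous_mxP _ _).1 (H x Ux)).
  by apply/continuous_mxP => i j; exact: H.
split=> [[H1 H2] i j|H].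
  split=> [x Ux|v]; first exact: ((differentiable_mxP _ _).1 (H1 x Ux)).
  have /IH /(_ i j) := H2 v; apply: Ck_on_eq => // x /set_mem Ux.
  by rewrite derive_mx ?mxE//; apply: diff_derivable; auto.
have D x : U x -> differentiable F x.
  by move=> Ux; apply/differentiable_mxP => i j; have [] := H i j; auto.
split=> // v; apply/IH => i j.
have [_ /(_ v)] := H i j; apply: Ck_on_eq => // x /set_mem Ux.
by rewrite derive_mx ?mxE//; apply: diff_derivable; auto.
Qed.

Lemma Ck_on_mulmx k (U : set V) m n p (F : V -> 'M[R]_(m, n)) (G : V -> 'M[R]_(n, p)) :
  open U -> Ck_on k U F -> Ck_on k U G -> Ck_on k U (fun x => F x *m G x).
Proof.
move=> oU /Ck_on_mxP F1 /Ck_on_mxP G1; apply/Ck_on_mxP => // i j.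
have := @Ck_on_sum k U R 'I_n (index_enum _) (fun l x => F x i l * G x l j) oU.
move=> H; apply: Ck_on_eq (H _) => //.
  by move=> x _; rewrite mxE.
by move=> l; apply: Ck_onM; [|exact: F1|exact: G1].
Qed.

Lemma Ck_on_trmx k (U : set V) m n (F : V -> 'M[R]_(m, n)) :
  open U -> Ck_on k U F -> Ck_on k U (fun x => (F x)^T).
Proof.
move=> oU /Ck_on_mxP F1; apply/Ck_on_mxP => // i j.
by apply: Ck_on_eq (F1 oU j i) => // x _; rewrite mxE.
Qed.

End Ck.

Lemma derive_rV_sum (R : realType) (W : normedModType R) n (f : 'rV[R]_n -> W) x v :
  differentiable f x ->
  'D_v f x = \sum_i v 0 i *: 'D_(delta_mx 0 i) f x.
Proof.
move=> df; rewrite deriveE// {1}(row_sum_delta v) linear_sum.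
by apply: eq_bigr => i _; rewrite linearZ deriveE.
Qed.

Lemma derive_chain (R : realType) (V V' W : normedModType R) (f : V' -> W) (g : V -> V') x v :
  differentiable g x -> differentiable f (g x) ->
  'D_v (f \o g) x = 'D_('D_v g x) f (g x).
Proof.
move=> dg df; rewrite (deriveE _ (differentiable_comp dg df)) (diff_comp dg df).
by rewrite /= (deriveE _ df) (deriveE _ dg).
Qed.

(** Expanding the chain rule along the canonical basis of the middle space leaves only products of
    scalar functions, so an induction on [k] that generalises [f] closes. *)
Lemma Ck_on_comp (R : realType) (V : normedModType R) n (W : set 'rV[R]_n)
    (U : set V) (f : 'rV[R]_n -> R) (g : V -> 'rV[R]_n) k :
  open U -> (forall x, U x -> W (g x)) ->
  Ck_on k W f -> Ck_on k U g -> Ck_on k U (f \o g).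
Proof.
move=> oU UW; elim: k f => [f Hf Hg x Ux|k IH f].
  by apply: continuous_comp; [exact: Hg|exact/Hf/UW].
move=> [Hf1 Hf2] Hg; have [Hg1 Hg2] := Hg.
split=> [x Ux|v]; first by apply: differentiable_comp; auto.
have H i : Ck_on k U (fun x => 'D_v g x 0 i * ('D_(delta_mx 0 i) f \o g) x).
  apply: Ck_onM => //; last by apply: IH (Hf2 _) (Ck_onS Hg).
  by have /Ck_on_mxP := Hg2 v; exact.
have := @Ck_on_sum R V k U R _ (index_enum 'I_n) _ oU H.
apply: Ck_on_eq => // x /set_mem Ux.
have df := Hf1 _ (UW _ Ux).
by rewrite (derive_chain v (Hg1 _ Ux) df) (derive_rV_sum _ df).
Qed.

Lemma Ck_on_comp_mx (R : realType) (V : normedModType R) n p q (W : set 'rV[R]_n)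
    (U : set V) (f : 'rV[R]_n -> 'M[R]_(p, q)) (g : V -> 'rV[R]_n) k :
  open W -> open U -> (forall x, U x -> W (g x)) ->
  Ck_on k W f -> Ck_on k U g -> Ck_on k U (f \o g).
Proof.
move=> oW oU UW /Ck_on_mxP Hf Hg; apply/Ck_on_mxP => // i j.
exact: Ck_on_comp (Hf oW i j) Hg.
Qed.

Section Affine.
Variables (R : realType) (V V' W : normedModType R).
Variables (A : V -> V') (l : V -> V').
Hypothesis Al : forall h v x, A (h *: v + x) = h *: l v + A x.

Lemma derive_affine (f : V' -> W) v x : 'D_v (f \o A) x = 'D_(l v) f (A x).
Proof. by rewrite /derive /=; under eq_fun do rewrite Al. Qed.

(** Serves for insertions such as [x |-> (x, y)] into a product space, whereas the middle space of
    [Ck_on_comp] is a space of rows. *)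
Lemma Ck_on_affine k (U : set V) (U' : set V') (f : V' -> W) :
  (forall x, differentiable A x) -> (forall x, U x -> U' (A x)) ->
  Ck_on k U' f -> Ck_on k U (f \o A).
Proof.
move=> dA UU'; elim: k f => [f H x Ux|k IH f [H1 H2]].
  by apply: continuous_comp; [exact/differentiable_continuous|exact/H/UU'].
split=> [x Ux|v]; first by apply: differentiable_comp; auto.
have -> : 'D_v (f \o A) = 'D_(l v) f \o A.
  by apply/funext => x; rewrite derive_affine.
exact/IH/H2.
Qed.

End Affine.

(** * Symmetry of second derivatives *)

Section Schwarz.
Variables (R : realType) (V : normedModType R).

Lemma differentiable_line (u y : V) (a : R) :
  differentiable (fun a : R => a *: u + y) a.
Proof.
apply: differentiableD; last exact: differentiable_cst.
by apply: differentiableZl.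
Qed.

Lemma is_derive_line (W : normedModType R) (g : V -> W) (u y : V) (a : R) :
  differentiable g (a *: u + y) ->
  is_derive a 1 (fun a : R => g (a *: u + y)) ('D_u g (a *: u + y)).
Proof.
move=> dg; apply: DeriveDef.
  apply/diff_derivable/(differentiable_comp (differentiable_line u y a)) => //.
rewrite (@derive_affine _ _ _ _ (fun a : R => a *: u + y) (fun a => a *: u)).
  by rewrite scale1r.
by move=> h v b; rewrite scalerDl scalerA addrA.
Qed.

(** The mean value theorem is used twice: along [u] for the increment of [f] by [s *: v], then along
    [v] for ['D_u f]. *)
Lemma second_difference (U : set V) (f : V -> R) (x u v : V) (s : R) :
  Ck_on 2 U f -> 0 < s ->
  (forall a b, 0 <= a <= s -> 0 <= b <= s -> U (a *: u + b *: v + x)) ->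
  exists a b, [/\ 0 <= a <= s, 0 <= b <= s &
    f (s *: u + s *: v + x) - f (s *: u + x) - f (s *: v + x) + f x =
    s * s * 'D_v ('D_u f) (a *: u + b *: v + x)].
Proof.
move=> [df /(_ u)[ddf _]] s0 Us.
have U0 a : 0 <= a <= s -> U (a *: u + x).
  move=> ha; have := Us a 0 ha; rewrite scale0r addr0; apply.
  by rewrite lexx ltW.
have Us' a : 0 <= a <= s -> U (a *: u + (s *: v + x)).
  by move=> ha; rewrite addrA; apply: Us => //; rewrite lexx ltW.
pose phi a := f (a *: u + (s *: v + x)) - f (a *: u + x).
have dphi a : 0 <= a <= s -> is_derive a 1 phi
    ('D_u f (a *: u + (s *: v + x)) - 'D_u f (a *: u + x)).
  by move=> ha; apply: is_deriveB; apply: is_derive_line; apply: df; auto.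
have sub01 a : a \in `]0, s[%R -> 0 <= a <= s.
  by rewrite in_itv/= => /andP[/ltW-> /ltW->].
have [|a /sub01 ha Ea] := MVT s0 (fun a ha => dphi a (sub01 _ ha)).
  by apply: derivable_within_continuous => a; rewrite in_itv/= => /dphi [].
pose psi b := 'D_u f (b *: v + (a *: u + x)).
have dpsi b : 0 <= b <= s -> is_derive b 1 psi ('D_v ('D_u f) (b *: v + (a *: u + x))).
  move=> hb; apply: is_derive_line; apply: ddf.
  by rewrite addrCA addrA; exact: Us.
have [|b /sub01 hb Eb] := MVT s0 (fun a ha => dpsi a (sub01 _ ha)).
  by apply: derivable_within_continuous => b; rewrite in_itv/= => /dpsi [].
exists a, b; split => //.
move: Ea Eb; rewrite /phi /psi !subr0 !scale0r !add0r => Ea Eb.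
rewrite -(addrA (a *: u)) (addrCA (a *: u)) -mulrA [s * 'D_v _ _]mulrC -Eb.
rewrite (addrCA (s *: v)) [s * _]mulrC -Ea -!addrA (addrA (s *: u)); congr (_ + _).
by rewrite opprB [f x - _]addrC.
Qed.

(** The second difference is symmetric in [u] and [v], so the two mixed derivatives take a common
    value at points close to [x]; continuity carries this to [x] up to any [e]. *)
Lemma derive_comm (U : set V) (f : V -> R) (x u v : V) :
  open U -> U x -> Ck_on 2 U f -> 'D_v ('D_u f) x = 'D_u ('D_v f) x.
Proof.
move=> oU Ux Cf; apply/eqP; rewrite -subr_eq0 -normr_le0; apply/ler_addgt0Pr => e e0.
rewrite add0r.
have Cuv w w' : {for x, continuous ('D_w ('D_w' f))}.
  by have [_ /(_ w')[_ /(_ w) +]] := Cf; exact.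
have e20 : 0 < e / 2 by rewrite divr_gt0.
have H : \forall y \near x, [/\ U y, `|'D_v ('D_u f) x - 'D_v ('D_u f) y| <= e / 2 &
   `|'D_u ('D_v f) x - 'D_u ('D_v f) y| <= e / 2].
  have A1 : \forall y \near x, U y. exact: (open_nbhs_nbhs (conj oU Ux)).
  have A2 : \forall y \near x, `|'D_v ('D_u f) x - 'D_v ('D_u f) y| <= e / 2.
    by have /cvgrPdist_le := Cuv v u; move=> /(_ _ e20).
  have A3 : \forall y \near x, `|'D_u ('D_v f) x - 'D_u ('D_v f) y| <= e / 2.
    by have /cvgrPdist_le := Cuv u v; move=> /(_ _ e20).
  by move: A1 A2 A3; apply: filterS3 => y B1 B2 B3; split.
have /nbhs_ballP[d /= d0 Hd] := H.
(* Small enough for the parallelogram with sides [s *: u] and [s *: v] at [x] to lie in the ball of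
   radius [d]. *)
pose s := d / (`|u| + `|v| + 1).
have n0 : 0 < `|u| + `|v| + 1 by rewrite ltr_wpDl// addr_ge0.
have s0 : 0 < s by rewrite divr_gt0.
have near_s a b : 0 <= a <= s -> 0 <= b <= s -> ball x d (a *: u + b *: v + x).
  move=> /andP[a0 sa] /andP[b0 sb]; rewrite -ball_normE/= opprD addrCA subrr addr0 normrN.
  apply: le_lt_trans (ler_normD _ _) _; rewrite !normrZ !ger0_norm//.
  apply: (@le_lt_trans _ _ (s * (`|u| + `|v|))).
    by rewrite mulrDr lerD// ler_wpM2r.
  by rewrite /s mulrAC ltr_pdivrMr// ltr_pM2l// ltrDl.
have [|a [b [ha hb E1]]] := @second_difference U f x u v s Cf s0.
  by move=> a b ha hb; have [] := Hd _ (near_s a b ha hb).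
have [|c [c' [hc hc' E2]]] := @second_difference U f x v u s Cf s0.
  by move=> c c' hc hc'; rewrite (addrC (c *: v)); have [] := Hd _ (near_s c' c hc' hc).
have ss : s * s != 0 by rewrite mulf_neq0// gt_eqF.
have E : 'D_v ('D_u f) (a *: u + b *: v + x) = 'D_u ('D_v f) (c' *: u + c *: v + x).
  apply: (mulfI ss); rewrite -E1 [c' *: u + _]addrC -E2 [s *: v + s *: u]addrC.
  by congr (_ + _); rewrite -!addrA; congr (_ + _); rewrite addrC.
have [_ A1 _] := Hd _ (near_s a b ha hb).
have [_ _ A2] := Hd _ (near_s c' c hc' hc).
rewrite -E distrC in A2.
rewrite (splitr e) -[X in `|X|](subrKA ('D_v ('D_u f) (a *: u + b *: v + x))).
exact: le_trans (ler_normD _ _) (lerD A1 A2).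
Qed.

End Schwarz.

(** * Ordinary differential equations *)

Section Norm.
Variable R : realType.

Lemma near_dist_le (V : normedModType R) (x : V) (e : R) :
  0 < e -> \forall y \near x, `|x - y| <= e.
Proof.
move=> e0; apply/nbhs_ballP; exists e => //= y.
by rewrite -ball_normE/=; exact: ltW.
Qed.

Lemma mx_norm_leP m n (x : 'M[R]_(m, n)) (e : R) : 0 <= e ->
  `|x| <= e <-> forall i j, `|x i j| <= e.
Proof.
move=> e0; rewrite /Num.Def.normr/= mx_normrE; split=> [H i j|H].
  by apply: le_trans H; exact: (le_bigmax _ (fun ij => `|x ij.1 ij.2|) (i, j)).
by apply: bigmax_le => // -[i j] _; exact: H.
Qed.

Lemma ler_mx_norm m n (x : 'M[R]_(m, n)) i j : `|x i j| <= `|x|.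
Proof. by have [+ _] := @mx_norm_leP m n x `|x| (normr_ge0 _); exact. Qed.

Lemma mulmx_norm m n p (x : 'M[R]_(m, n)) (y : 'M[R]_(n, p)) :
  `|x *m y| <= n%:R * `|x| * `|y|.
Proof.
apply/mx_norm_leP; first by rewrite !mulr_ge0.
move=> i j; rewrite mxE (le_trans (ler_norm_sum _ _ _))//.
rewrite -mulrA -[n in n%:R]card_ord [X in _ <= X]mulr_natl.
rewrite -sumr_const; apply: ler_sum => k _.
by rewrite normrM ler_pM// ler_mx_norm.
Qed.


End Norm.

Section MeanValue.
Variable R : realType.

(** Rows carry the maximum norm, so the scalar mean value theorem applied to each coordinate loses
    no constant. *)
Lemma mean_value_le n (x : R -> 'rV[R]_n) (dx : R -> 'rV[R]_n) (I : set R) (K s t : R) :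
  is_interval I -> 0 <= K ->
  (forall t, I t -> is_derive t 1 x (dx t)) -> (forall t, I t -> `|dx t| <= K) ->
  I s -> I t -> `|x t - x s| <= K * `|t - s|.
Proof.
move=> II K0 Ix dK.
have Ix' i u : I u -> is_derive u 1 (fun u => x u 0 i) (dx u 0 i).
  move=> /Ix [D1 D2]; apply: DeriveDef; first exact: (derivable_mxP _ _ _).1.
  by rewrite -D2 derive_mx// mxE.
wlog st : s t / s <= t => [H Is It|Is It].
  by have [/H|/ltW/H] := leP s t; [exact|rewrite distrC (distrC t); exact].
have sub u : u \in `[s, t]%R -> I u by rewrite in_itv/=; exact: II.
apply/mx_norm_leP => [|i j]; first by rewrite mulr_ge0.
rewrite [i]ord1 !mxE.
have cx : {within `[s, t], continuous (fun u => x u 0 j)}.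
  by apply: derivable_within_continuous => u /sub /(Ix' j) [].
have [u us ->] := MVT_segment st
  (fun u hu => Ix' j u (sub u (subset_itv_oo_cc hu))) cx.
by rewrite normrM ler_wpM2r// (le_trans (ler_mx_norm _ _ _))// dK//; exact: sub.
Qed.

Lemma derive0_constant n (x : R -> 'rV[R]_n) (I : set R) s t :
  is_interval I -> (forall t, I t -> is_derive t 1 x 0) -> I s -> I t -> x s = x t.
Proof.
move=> II Ix Is It; apply/eqP; rewrite -subr_eq0 -normr_le0.
have /= := @mean_value_le n x (fun=> 0) I 0 t s II (lexx _) Ix _ It Is.
by rewrite mul0r; apply => u _; rewrite normr0.
Qed.

End MeanValue.

Section ODE.
Variable R : realType.

Lemma continuous_primitive (f : R -> R) (T : R) :
  continuous f -> exists F : R -> R, forall t, -T < t < T -> is_derive t 1 F (f t).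
Proof.
move=> cf.
(* Integrating from [-T] rather than from 0 avoids oriented integrals for negative [t]. *)
exists (fun t => \int[lebesgue_measure]_(u in [set` `[-T, t]]) f u)%R => t /andP[Tt tT].
have intf : lebesgue_measure.-integrable `[-T, T] (EFin \o f).
  apply: continuous_compact_integrable; first exact: segment_compact.
  exact: continuous_subspaceT.
have [d e] := continuous_FTC1_closed tT intf Tt (cf t).
by apply: DeriveDef => //; rewrite -derive1E.
Qed.

Lemma continuous_primitive_rV n (f : R -> 'rV[R]_n) (T : R) :
  continuous f ->
  exists F : R -> 'rV[R]_n, forall t, -T < t < T -> is_derive t 1 F (f t).
Proof.
move=> cf.
have cfi i : continuous (fun t => f t 0 i).
  by move=> t; have /continuous_mxP := cf t; exact.
have /choice [F HF] i := continuous_primitive T (cfi i).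
exists (fun t => \row_i F i t) => t tT.
have D : derivable (fun t => \row_i F i t) t 1.
  apply/derivable_mxP => i j; under eq_fun do rewrite mxE.
  by have [] := HF j t tT.
apply: DeriveDef => //; rewrite derive_mx//; apply/rowP => j; rewrite !mxE.
by under eq_fun do rewrite mxE; have [_ ->] := HF j t tT; rewrite ?ord1.
Qed.

(** Nested intervals: [2 * d / 2 ^+ k] is the tail of the geometric series of increments, so the
    intervals of this radius around the [u k] decrease. *)
Lemma geometric_limit (u : nat -> R) (d : R) :
  (forall k, `|u k.+1 - u k| <= d / 2 ^+ k) ->
  exists l, forall k, `|l - u k| <= 2 * d / 2 ^+ k.
Proof.
move=> ud.
have E k : 2 * d / 2 ^+ k.+1 = d / 2 ^+ k.
  by rewrite exprS invfM mulrACA divff// mul1r.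
have E2 k : 2 * d / 2 ^+ k = d / 2 ^+ k + d / 2 ^+ k by rewrite -mulrA mulr2n mulrDl !mul1r.
pose a k := u k - 2 * d / 2 ^+ k; pose b k := u k + 2 * d / 2 ^+ k.
have aS k : a k <= a k.+1.
  by have := ud k; rewrite /a E E2 ler_norml; set z := d / _; lra.
have bS k : b k.+1 <= b k.
  by have := ud k; rewrite /b E E2 ler_norml; set z := d / _; lra.
have d0 : 0 <= d by have := ud 0%N; rewrite expr0 divr1; exact: le_trans.
have ab k : a k <= b k.
  have : 0 <= 2 * d / 2 ^+ k by rewrite divr_ge0// ?mulr_ge0// exprn_ge0.
  by rewrite /a /b; lra.
have am : {homo a : i j / (i <= j)%N >-> i <= j}.
  by apply: homo_leq => //; exact: le_trans.
have bm : {homo b : i j / (i <= j)%N >-> j <= i}.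
  by apply: homo_leq => // x y z; exact: ge_trans.
have abjk j k : a j <= b k.
  rewrite (le_trans (am _ _ (leq_maxl j k)))// (le_trans (ab _))//.
  by rewrite bm// leq_maxr.
have ubE k : ubound (range a) (b k) by move=> _ [j _ <-].
have hs : has_sup (range a).
  by split; [exists (a 0%N); exists 0%N|exists (b 0%N)].
exists (sup (range a)) => k; rewrite ler_norml.
have h1 : a k <= sup (range a) by apply: ub_le_sup; [exact: hs.2|exists k].
have h2 : sup (range a) <= b k by apply: ge_sup; [exact: hs.1|].
by move: h1 h2; rewrite /a /b; lra.
Qed.

Lemma lipschitz_continuous (V W : normedModType R) (f : V -> W) (K : R) :
  (forall x y, `|f x - f y| <= K * `|x - y|) -> continuous f.
Proof.
move=> fK x; apply/cvgrPdist_le => e e0.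
pose K' := Num.max K 1; have K'0 : 0 < K' by rewrite lt_max ltr01 orbT.
near=> y; apply: le_trans (fK _ _) _.
apply: (@le_trans _ _ (K' * `|x - y|)); first by rewrite ler_wpM2r// le_max lexx.
rewrite -ler_pdivlMl//; near: y.
by apply: near_dist_le; rewrite mulr_gt0// invr_gt0.
Unshelve. all: by end_near. Qed.

(** This 1-Lipschitz retraction makes local data global: in time for [lipschitz_ode], in each
    coordinate for [local_ode]. *)
Definition clamp (a b t : R) := Num.max a (Num.min b t).

Lemma clamp_bounds a b t : a <= b -> a <= clamp a b t <= b.
Proof. by move=> ab; rewrite /clamp le_max lexx/= ge_max ab/= ge_min lexx. Qed.

Lemma clamp_id a b t : a <= t <= b -> clamp a b t = t.
Proof. by move=> /andP[at_ tb]; rewrite /clamp (min_idPr tb) (max_idPr at_). Qed.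

Lemma max_lipschitz (a s t : R) : `|Num.max a s - Num.max a t| <= `|s - t|.
Proof.
have h3 := ler_norm (s - t); have h4 := ler_norm (t - s); rewrite distrC in h4.
by case: (leP a s) => h1; case: (leP a t) => h2; rewrite ler_norml; lra.
Qed.

Lemma clamp_lipschitz a b s t : `|clamp a b s - clamp a b t| <= `|s - t|.
Proof.
rewrite (le_trans (max_lipschitz _ _ _))//.
rewrite -[Num.min b s]opprK -[Num.min b t]opprK !oppr_min -opprD normrN.
by rewrite (le_trans (max_lipschitz _ _ _))// -opprD normrN.
Qed.

Lemma clamp_continuous a b : continuous (clamp a b).
Proof.
apply: (@lipschitz_continuous R R _ 1) => s t.
by rewrite mul1r; exact: clamp_lipschitz.
Qed.

Lemma is_derive_continuous n (x : R -> 'rV[R]_n) (dx : 'rV[R]_n) (t : R) :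
  is_derive t 1 x dx -> {for t, continuous x}.
Proof. by move=> [/derivable1_diffP d _]; exact: differentiable_continuous. Qed.

Lemma is_interval_oo (a b : R) : is_interval [set t | a < t < b].
Proof.
move=> s t /= /andP[a1 _] /andP[_ b1] u /andP[su ut].
by rewrite (lt_le_trans a1)// (le_lt_trans ut).
Qed.

(** Picard iteration. Clamping time makes every iterate a continuous function on the whole line, and
    [K * tau <= 2^-1] makes the integral operator [P] a contraction of factor 1/2 for the supremum
    norm. *)
Lemma lipschitz_ode n (f : 'rV[R]_n -> 'rV[R]_n) (K tau : R) x0 :
  0 <= K -> (forall x y, `|f x - f y| <= K * `|x - y|) ->
  0 < tau -> K * tau <= 2^-1 ->
  exists2 x : R -> 'rV[R]_n, x 0 = x0 &
    forall t, -tau < t < tau -> is_derive t 1 x (f (x t)).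
Proof.
move=> K0 fK t0 Kt.
have cf := lipschitz_continuous fK.
pose c := clamp (- tau) tau.
have cB t : -tau <= c t <= tau by apply: clamp_bounds; lra.
have cI t : - (2 * tau) < c t < 2 * tau by have := cB t; lra.
have c0 : c 0 = 0 by apply: clamp_id; lra.
pose I := [set t | - (2 * tau) < t < 2 * tau].
have II : is_interval I by exact: is_interval_oo.
have I0 : I 0 by rewrite /I/=; lra.
(* The primitives live on an interval twice as long, so that they are differentiable at the clamped
   times [tau] and [- tau] too; discontinuous [y] get a dummy value. *)
have /choice [F HF] y : exists F : R -> 'rV[R]_n, continuous y ->
    forall t, I t -> is_derive t 1 F (f (y t)).
  have [cy|ncy] := pselect (continuous y); last by exists (fun=> 0).
  have [|F HF] := @continuous_primitive_rV n (f \o y) (2 * tau).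
    by move=> t; apply: continuous_comp; [exact: cy|exact: cf].
  by exists F.
pose P y t := F y (c t) - F y 0 + x0.
have P0 y : P y 0 = x0 by rewrite /P c0 subrr add0r.
have Pc y : continuous y -> continuous (P y).
  move=> cy t; apply: cvgD; last exact: cvg_cst.
  apply: cvgB; last exact: cvg_cst.
  have cFc : {for c t, continuous (F y)}.
    exact: is_derive_continuous (HF _ cy _ (cI t)).
  exact: (continuous_comp (@clamp_continuous (- tau) tau t) cFc).
have Pcontr y z d : continuous y -> continuous z -> 0 <= d ->
    (forall t, `|y t - z t| <= d) -> forall t, `|P y t - P z t| <= d / 2.
  move=> cy cz d0 yz t.
  have -> : P y t - P z t = (F y - F z) (c t) - (F y - F z) 0.
    by rewrite /P !fctE; apply/rowP => i; rewrite !mxE; ring.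
  have D u : I u -> is_derive u 1 (F y - F z) (f (y u) - f (z u)).
    by move=> Iu; apply: is_deriveB; exact: HF.
  have B u : I u -> `|f (y u) - f (z u)| <= K * d.
    by move=> _; rewrite (le_trans (fK _ _))// ler_wpM2l.
  apply: le_trans (mean_value_le II (mulr_ge0 K0 d0) D B I0 (cI t)) _.
  have ct : `|c t - 0| <= tau by rewrite subr0 ler_norml cB.
  apply: le_trans (ler_wpM2l (mulr_ge0 K0 d0) ct) _.
  by rewrite mulrAC mulrC ler_wpM2l.
pose u k := iter k P (fun=> x0).
have uc k : continuous (u k).
  by elim: k => [|k IH]; [move=> ?; exact: cvg_cst|exact: Pc].
pose d := tau * `|f x0|.
have d0 : 0 <= d by rewrite mulr_ge0// ltW.
have ud k : forall t, `|u k.+1 t - u k t| <= d / 2 ^+ k.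
  elim: k => [t|k IH t].
    rewrite expr0 divr1 /u/= /P addrK.
    have D v : I v -> is_derive v 1 (F (fun=> x0)) (f x0).
      have cx0 : continuous (fun _ : R => x0) by move=> ?; exact: cvg_cst.
      exact: HF.
    apply: le_trans (mean_value_le II (normr_ge0 (f x0)) D (fun=> fun=> lexx _) I0 (cI t)) _.
    by rewrite mulrC ler_wpM2r// subr0 ler_norml cB.
  rewrite exprSr invfM mulrA; apply: (Pcontr (u k.+1) (u k) _ (uc _) (uc _) _ IH).
  by rewrite divr_ge0// exprn_ge0.
have k0 k : 0 <= 2 * d / 2 ^+ k by apply: divr_ge0; [apply: mulr_ge0|apply: exprn_ge0].
have [x Hx] : exists x : R -> 'rV[R]_n, forall t k, `|x t - u k t| <= 2 * d / 2 ^+ k.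
  have H t i : exists l : R, forall k, `|l - u k t 0 i| <= 2 * d / 2 ^+ k.
    apply: (@geometric_limit (fun k => u k t 0 i)) => k.
    by apply: le_trans (ud k t); apply: le_trans (ler_mx_norm _ 0 i); rewrite !mxE.
  have /choice [x Hx] (t : R) : exists xt : 'rV[R]_n,
      forall i k, `|xt 0 i - u k t 0 i| <= 2 * d / 2 ^+ k.
    have /choice [l Hl] := H t.
    by exists (\row_i l i) => i k; rewrite mxE.
  exists x => t k; apply/mx_norm_leP; first exact: k0.
  by move=> i j; rewrite ord1 !mxE.
have small e : 0 < e -> exists k, 2 * d / 2 ^+ k <= e.
  have q : `|2^-1 : R| < 1 by rewrite ger0_norm// invf_lt1// ltr1n.
  move=> e0; have /cvgrPdist_le /(_ _ e0) [k _] := @cvg_geometric R (2 * d) _ q.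
  move=> /(_ k (leqnn k))/=; rewrite sub0r normrN exprVn => h; exists k.
  exact: le_trans (ler_norm _) h.
have cx : continuous x.
  move=> t; apply/cvgrPdist_le => e e0.
  have [k hk] := small (e / 3) ltac:(lra).
  near=> s; rewrite -(subrKA (u k t)) (le_trans (ler_normD _ _))//.
  rewrite -(subrKA (u k s) (u k t)).
  have h1 := Hx t k; have h2 := Hx s k; rewrite distrC in h2.
  have h3 := ler_normD (u k t - u k s) (u k s - x s).
  have h4 : `|u k t - u k s| <= e / 3.
    near: s; apply: cvgr_dist_le; last by lra.
    exact: uc.
  by lra.
have Px t : P x t = x t.
  apply/eqP; rewrite -subr_eq0 -normr_le0; apply/ler_addgt0Pr => e e0; rewrite add0r.
  have [k hk] := small (e / 2) ltac:(lra).
  rewrite -(subrKA (u k.+1 t)) (le_trans (ler_normD _ _))//.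
  have h1 := Pcontr x (u k) _ cx (uc k) (k0 k) (Hx^~ k) t.
  have h2 := Hx t k.+1; rewrite distrC exprSr invfM mulrA in h2.
  rewrite -[P (u k) t]/(u k.+1 t) in h1.
  by lra.
exists x => [|t tt]; first by rewrite -Px.
have tI : I t by rewrite /I/=; lra.
have D : is_derive t 1 (fun s => F x s - F x 0 + x0) (f (x t)).
  rewrite -[f (x t)]addr0 -[f (x t)]subr0.
  by apply: is_deriveD; apply: is_deriveB; exact: HF.
apply: near_eq_is_derive D.
have oI : open [set s : R | -tau < s < tau].
  by rewrite (_ : [set s | _] = `]-tau, tau[%classic); [exact: interval_open|rewrite set_itvE].
apply: open_near_eq oI tt _ => s; rewrite inE/= => hs.
rewrite -Px /P /c clamp_id//; lra.
Unshelve. all: by end_near. Qed.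

End ODE.

(** * Lifetime bounds, local uniqueness and smoothness of solutions *)

Section LocalODE.
Variable R : realType.

Lemma rclamp_lipschitz n (a rho : R) (x y : 'rV[R]_n) (x0 : 'rV[R]_n) :
  let pi (z : 'rV[R]_n) := \row_i clamp (x0 0 i - rho) (x0 0 i + rho) (z 0 i) in
  `|pi x - pi y| <= `|x - y|.
Proof.
apply/mx_norm_leP => // i j; rewrite !ord1 !mxE.
rewrite (le_trans (clamp_lipschitz _ _ _ _))//.
by have := ler_mx_norm (x - y) 0 j; rewrite !mxE.
Qed.

(** The order of quantifiers is the point: [tau] is fixed before the field and the initial value,
    which yields a common lifetime for a whole family of fields. The field is clamped to the ball of
    radius [rho], and the solution stays where clamping is the identity. *)
Lemma local_ode n (K C rho : R) : 0 <= K -> 0 <= C -> 0 < rho ->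
  exists2 tau : R, 0 < tau &
  forall (f : 'rV[R]_n -> 'rV[R]_n) (x0 : 'rV[R]_n), `|f x0| <= C ->
  (forall x y, `|x - x0| <= rho -> `|y - x0| <= rho -> `|f x - f y| <= K * `|x - y|) ->
  exists2 x : R -> 'rV[R]_n, x 0 = x0 &
    forall t, -tau < t < tau -> `|x t - x0| <= rho /\ is_derive t 1 x (f (x t)).
Proof.
move=> K0 C0 r0.
pose M := C + K * rho.
have M0 : 0 <= M by rewrite addr_ge0// mulr_ge0// ltW.
(* The first bound gives [K * tau <= 2^-1]; the second keeps the solution, of speed at most [M],
   within distance [rho]. *)
pose tau := Num.min (2 * K + 1)^-1 (rho / (M + 1)).
have tau1 : tau <= (2 * K + 1)^-1 by rewrite ge_min lexx.
have tau2 : tau <= rho / (M + 1) by rewrite ge_min lexx orbT.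
have t0 : 0 < tau by rewrite lt_min invr_gt0 divr_gt0 ?ltr_wpDl// mulr_ge0.
exists tau => // f x0 fC fK.
pose pi (z : 'rV[R]_n) := \row_i clamp (x0 0 i - rho) (x0 0 i + rho) (z 0 i).
have piL x y : `|pi x - pi y| <= `|x - y| by exact: rclamp_lipschitz.
have piB x : `|pi x - x0| <= rho.
  apply/mx_norm_leP => [|i j]; first exact: ltW.
  rewrite !mxE ord1 ler_norml.
  have := @clamp_bounds _ (x0 0 j - rho) (x0 0 j + rho) (x 0 j) ltac:(lra).
  by lra.
have piE x : `|x - x0| <= rho -> pi x = x.
  move=> /mx_norm_leP h; apply/rowP => i; rewrite mxE clamp_id//.
  by have := h (ltW r0) 0 i; rewrite !mxE ler_norml; lra.
have fK' x y : `|f (pi x) - f (pi y)| <= K * `|x - y|.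
  by rewrite (le_trans (fK _ _ _ _))// ler_wpM2l.
have Kt : K * tau <= 2^-1.
  apply: le_trans (ler_wpM2l K0 tau1) _.
  by rewrite ler_pdivrMr; lra.
have [x x00 Dx] := @lipschitz_ode _ n (f \o pi) K tau x0 K0 fK' t0 Kt.
exists x => // t tt.
have II := @is_interval_oo R (-tau) tau.
have B (s : R) : -tau < s < tau -> `|f (pi (x s))| <= M.
  move=> _; rewrite -[f _](subrK (f x0)) (le_trans (ler_normD _ _))// addrC lerD//.
  rewrite (le_trans (fK _ _ _ _))// ?subrr ?normr0 ?ler_wpM2l//.
  exact: ltW.
have h : `|x t - x0| <= rho.
  rewrite -x00.
  have I0 : -tau < 0 < tau by lra.
  apply: le_trans (mean_value_le II M0 Dx B I0 tt) _.
  rewrite subr0; apply: (@le_trans _ _ (M * (rho / (M + 1)))).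
    by rewrite ler_wpM2l// ler_norml; lra.
  by rewrite mulrA ler_pdivrMr ?ltr_wpDl//; nra.
by split => //; have := Dx t tt; rewrite /= piE.
Qed.

(** Continuous partial derivatives are bounded near [x0], and balls are convex: the mean value
    theorem applies on segments, with a factor [n] from summing over the coordinates. *)
Lemma C1_lipschitz n p q (U : set 'rV[R]_n) (S : 'rV[R]_n -> 'M[R]_(p, q)) (x0 : 'rV[R]_n) :
  open U -> U x0 -> Ck_on 1 U S ->
  exists rho K : R, [/\ 0 < rho, 0 <= K, (forall x, `|x - x0| <= rho -> U x) &
   (forall x y, `|x - x0| <= rho -> `|y - x0| <= rho -> `|S x - S y| <= K * `|x - y|)].
Proof.
move=> oU Ux0 CS; have [dS cS] := CS.
have [M M0 HM] : exists2 M : R, 0 <= M & \forall x \near x0, forall k,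
    `|'D_(delta_mx 0 k) S x| <= M.
  (* The sum dominates each partial derivative at [x0], and the 1 absorbs its variation nearby, so
     one bound serves all directions. *)
  exists (1 + \sum_k `|'D_(delta_mx 0 k) S x0|); first by rewrite addr_ge0 ?sumr_ge0.
  have H k : \forall x \near x0,
      `|'D_(delta_mx 0 k) S x| <= 1 + \sum_k `|'D_(delta_mx 0 k) S x0|.
    have /cvgrPdist_le /(_ _ ltr01) := cS (delta_mx 0 k) x0 Ux0.
    apply: filterS => x hx; rewrite (bigD1 k)//= addrA.
    rewrite -[leLHS]addr0 lerD ?sumr_ge0//.
    rewrite -['D_ _ S x](subrK ('D_(delta_mx 0 k) S x0)) (le_trans (ler_normD _ _))//.
    by rewrite distrC in hx; exact: lerD hx (lexx _).
  exact: filter_forall H.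
have : \forall x \near x0, U x /\ forall k, `|'D_(delta_mx 0 k) S x| <= M.
  exact: filterI (open_nbhs_nbhs (conj oU Ux0)) HM.
move=> /nbhs_ballP[d /= d0 Hd].
have Hd' x : `|x - x0| <= d / 2 -> U x /\ forall k, `|'D_(delta_mx 0 k) S x| <= M.
  by move=> h; apply: Hd; rewrite -ball_normE/= distrC (le_lt_trans h)//; lra.
exists (d / 2), (n%:R * M); split; [lra|by rewrite mulr_ge0|by move=> x /Hd'[]|].
move=> x y hx hy.
have seg (t : R) : 0 <= t <= 1 -> `|t *: (x - y) + y - x0| <= d / 2.
  move=> t01.
  have -> : t *: (x - y) + y - x0 = t *: (x - x0) + (1 - t) *: (y - x0).
    by apply/rowP => i; rewrite !mxE; ring.
  rewrite (le_trans (ler_normD _ _))// !normrZ !ger0_norm; [|lra|lra].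
  by nra.
apply/mx_norm_leP => [|i j]; first by rewrite !mulr_ge0.
have dij : forall t : R, 0 <= t <= 1 -> differentiable (fun z => S z i j) (t *: (x - y) + y).
  move=> t /seg/Hd'[Ut _]; have /differentiable_mxP := dS _ Ut; exact.
have D (t : R) : t \in `[0, 1]%R -> is_derive t 1 (fun t : R => S (t *: (x - y) + y) i j)
   ('D_(x - y) (fun z => S z i j) (t *: (x - y) + y)).
  rewrite in_itv/= => t01.
  exact: (@is_derive_line _ _ _ (fun z => S z i j : R) _ _ _ (dij t t01)).
have cD : {within `[0, 1], continuous (fun t : R => S (t *: (x - y) + y) i j)}.
  by apply: derivable_within_continuous => t /D [].
have [t t01] := MVT_segment ler01 (fun t ht => D t (subset_itv_oo_cc ht)) cD.
rewrite in_itv/= in t01.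
rewrite scale1r subrK scale0r add0r subr0 mulr1 !mxE => ->.
rewrite (derive_rV_sum _ (dij t t01)) (le_trans (ler_norm_sum _ _ _))//.
have [Ut HMt] := Hd' _ (seg t t01).
rewrite -mulrA -[n in n%:R]card_ord [X in _ <= X]mulr_natl -sumr_const.
apply: ler_sum => k _; rewrite normrM mulrC ler_pM ?ler_mx_norm//.
apply: le_trans (HMt k); apply: le_trans (ler_mx_norm _ i j).
by rewrite derive_mx ?mxE//; apply: diff_derivable; exact: dS.
Qed.

(** Instead of a Gronwall estimate: on an interval of radius [e] with [K * e <= 2^-1], any bound on
    [x - y] can be halved, hence halved for ever. *)
Lemma local_uniqueness n (f : 'rV[R]_n -> 'rV[R]_n) (x y : R -> 'rV[R]_n)
    (t0 K rho : R) :
  0 < rho -> 0 <= K ->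
  (forall u v, `|u - x t0| <= rho -> `|v - x t0| <= rho -> `|f u - f v| <= K * `|u - v|) ->
  (\forall t \near t0, is_derive (t : R) 1 x (f (x t))) ->
  (\forall t \near t0, is_derive (t : R) 1 y (f (y t))) ->
  x t0 = y t0 -> \forall t \near t0, x t = y t.
Proof.
move=> r0 K0 fK Dx Dy xy0.
have cont (z : R -> 'rV[R]_n) : (\forall t \near t0, is_derive (t : R) 1 z (f (z t))) ->
    \forall t \near t0, `|z t - z t0| <= rho.
  move=> Dz; have cz : {for t0, continuous z} := is_derive_continuous (nbhs_singleton Dz).
  have /cvgrPdist_le /(_ _ r0) := cz.
  by apply: filterS => t; rewrite distrC.
have : \forall t \near t0,
    (is_derive (t : R) 1 x (f (x t)) /\ is_derive (t : R) 1 y (f (y t))) /\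
    (`|x t - x t0| <= rho /\ `|y t - y t0| <= rho).
  exact: filterI (filterI Dx Dy) (filterI (cont _ Dx) (cont _ Dy)).
move=> /nbhs_ballP[d /= d0 Hd].
pose e := Num.min d (2 * K + 1)^-1.
have e1 : e <= d by rewrite ge_min lexx.
have e2 : e <= (2 * K + 1)^-1 by rewrite ge_min lexx orbT.
have e0 : 0 < e by rewrite lt_min d0/= invr_gt0 ltr_wpDl// mulr_ge0.
have Ke : K * e <= 2^-1.
  apply: le_trans (ler_wpM2l K0 e2) _.
  by rewrite ler_pdivrMr; lra.
have He (t : R) : t0 - e < t < t0 + e ->
    [/\ is_derive t 1 x (f (x t)), is_derive t 1 y (f (y t)),
    `|x t - x t0| <= rho & `|y t - x t0| <= rho].
  move=> tI; have [] := Hd t; last by rewrite -xy0 => -[? ?] [? ?]; split.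
  by rewrite -ball_normE/= ltr_norml; lra.
have II := @is_interval_oo R (t0 - e) (t0 + e).
have I0 : t0 - e < t0 < t0 + e by lra.
have bound k : forall t, t0 - e < t < t0 + e -> `|x t - y t| <= (2 * rho) / 2 ^+ k.
  elim: k => [t tI|k IH t tI].
    rewrite expr0 divr1 -(subrKA (x t0)) (le_trans (ler_normD _ _))//.
    by have [_ _ h1 h2] := He t tI; rewrite (distrC (x t0)); lra.
  set b := 2 * rho / 2 ^+ k in IH.
  have b0 : 0 <= b by apply: le_trans (IH t0 I0).
  have D (s : R) : t0 - e < s < t0 + e -> is_derive s 1 (x - y) (f (x s) - f (y s)).
    by move=> /He[? ? _ _]; exact: is_deriveB.
  have B (s : R) : t0 - e < s < t0 + e -> `|f (x s) - f (y s)| <= K * b.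
    move=> sI; have [_ _ h1 h2] := He s sI.
    by rewrite (le_trans (fK _ _ h1 h2))// ler_wpM2l// IH.
  have := mean_value_le II (mulr_ge0 K0 b0) D B I0 tI.
  rewrite !fctE xy0 subrr subr0 => /le_trans; apply.
  apply: (@le_trans _ _ (K * b * e)).
    apply: ler_wpM2l; first exact: mulr_ge0.
    by rewrite ler_norml; lra.
  have Kbe : K * b * e <= b / 2 by rewrite mulrAC [_ * b]mulrC; exact: ler_wpM2l.
  by rewrite exprSr invfM [leRHS]mulrA.
apply/nbhs_ballP; exists e => //= t; rewrite -ball_normE/= ltr_norml => tI.
apply/eqP; rewrite -subr_eq0 -normr_le0; apply/ler_addgt0Pr => eta eta0; rewrite add0r.
have q : `|2^-1 : R| < 1 by rewrite ger0_norm// invf_lt1// ltr1n.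
have /cvgrPdist_le /(_ _ eta0) [k _] := @cvg_geometric R (2 * rho) _ q.
move=> /(_ k (leqnn k))/=; rewrite sub0r normrN exprVn => h.
apply: le_trans (bound k t _) (le_trans (ler_norm _) h).
by lra.
Qed.

(** Bootstrap: if [x] is of class C^k then so is its derivative [f \o x], and [x] is of class
    C^(k+1). *)
Lemma ode_smooth n (W : set 'rV[R]_n) (f : 'rV[R]_n -> 'rV[R]_n) (V : set R)
    (x : R -> 'rV[R]_n) :
  open W -> open V -> smooth_on W f -> (forall t, V t -> W (x t)) ->
  (forall t, V t -> is_derive t 1 x (f (x t))) ->
  smooth_on (V : set R^o) (x : R^o -> 'rV[R]_n).
Proof.
move=> oW oV sf VW Dx.
have dx t : V t -> differentiable (x : R^o -> 'rV[R]_n) t.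
  by move=> /Dx[d _]; exact/derivable1_diffP.
elim=> [t /dx|k IH]; first exact: differentiable_continuous.
split=> // v.
have := Ck_on_comp_mx oW oV VW (sf k) IH => C.
(* The scalar [v] is written as a 1 by 1 matrix, so that scaling is a case of [Ck_on_mulmx]. *)
have C2 := Ck_on_mulmx oV (Ck_on_cst k V (v%:M : 'M[R]_1)) C.
apply: (Ck_on_eq _ _ C2) => // t /set_mem Vt.
rewrite /= mul_scalar_mx.
rewrite deriveE; last exact: dx.
rewrite -[v]mulr1 linearZ/= -deriveE; last exact: dx.
by have [_ ->] := Dx t Vt; rewrite mulr1.
Qed.

End LocalODE.

(** * Jacobians in charts *)

Section Jacobian.
Variable R : realType.

Lemma mulmx_row_ext m n (A B : 'M[R]_(m, n)) :
  (forall v : 'rV_m, v *m A = v *m B) -> A = B.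
Proof. by move=> AB; apply/row_matrixP => i; rewrite !rowE. Qed.

Lemma near_eq_jacobian m n (f g : 'rV[R]_m -> 'rV[R]_n) x :
  differentiable f x -> (\forall y \near x, f y = g y) -> 'J f x = 'J g x.
Proof.
move=> df fg; have dg := near_eq_differentiable fg df.
apply: mulmx_row_ext => v.
exact: etrans (esym (deriveEjacobian v df))
  (etrans (near_eq_derive v fg) (deriveEjacobian v dg)).
Qed.

Lemma jacobian_comp m n p (g : 'rV[R]_n -> 'rV[R]_p) (f : 'rV[R]_m -> 'rV[R]_n) x :
  differentiable f x -> differentiable g (f x) ->
  'J (g \o f) x = 'J f x *m 'J g (f x).
Proof.
move=> df dg; apply: mulmx_row_ext => v.
apply: etrans (esym (deriveEjacobian v (differentiable_comp df dg))) _.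
apply: etrans (derive_chain v df dg) _; apply: etrans (deriveEjacobian _ dg) _.
by rewrite mulmxA; congr (_ *m _); exact: deriveEjacobian.
Qed.

Lemma jacobian_id n (x : 'rV[R]_n) : 'J id x = 1%:M.
Proof.
have did : differentiable (@id 'rV[R]_n) x by [].
apply: mulmx_row_ext => v; rewrite mulmx1.
exact: etrans (esym (deriveEjacobian v did)) (derive_id x v).
Qed.

Lemma jacobianE m n (f : 'rV[R]_m -> 'rV[R]_n) x i j :
  differentiable f x -> 'J f x i j = 'D_(delta_mx 0 i) f x 0 j.
Proof. by move=> df; rewrite (deriveEjacobian _ df) -rowE [RHS]mxE. Qed.

End Jacobian.

Section Manifold.
Variables (R : realType) (n : nat) (M : smoothManifoldType R n).
Implicit Types (c d e : chart R n M) (F : M -> M) (p : M).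

(** For [F := id] this is convertible to the Jacobian in [gmx_change], so that changes of charts are
    instances of the chain rule [jac_comp]. *)
Definition jac F c d p : 'M[R]_n := 'J (cfwd d \o F \o cbwd c) (cfwd c p).

Lemma near_chart c p (A : set M) : cdom c p -> nbhs p A ->
  \forall x \near cfwd c p, cimg c x /\ A (cbwd c x).
Proof.
move=> cp Ap; apply: filterI.
  by apply: open_nbhs_nbhs; split; [exact: open_cimg|exact: cfwd_img].
have := cbwd_continuous (cfwd_img cp); apply.
by rewrite /= cfwdK.
Qed.

Lemma near_cdom c p : cdom c p -> nbhs p (cdom c).
Proof. by move=> cp; apply: open_nbhs_nbhs; split; [exact: open_cdom|]. Qed.

Lemma smooth_map_id : smooth_map (id : M -> M).
Proof. by split=> [x|c d ac ad]; [exact: cvg_id|exact: atlas_compatible]. Qed.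

Lemma smooth_map_chart F c d p : smooth_map F -> atlas c -> atlas d ->
  cdom c p -> cdom d (F p) -> differentiable (cfwd d \o F \o cbwd c) (cfwd c p).
Proof.
move=> [_ sF] ac ad cp dp; apply: smooth_on_differentiable (sF c d ac ad) _.
by split; [exact: cfwd_img|rewrite /= cfwdK].
Qed.

Lemma jac_comp F F' c d e p : smooth_map F -> smooth_map F' ->
  atlas c -> atlas d -> atlas e ->
  cdom c p -> cdom d (F p) -> cdom e (F' (F p)) ->
  jac (F' \o F) c e p = jac F c d p *m jac F' d e (F p).
Proof.
move=> sF sF' ac ad ae cp dp ep.
have D1 := smooth_map_chart sF ac ad cp dp.
have D2 := smooth_map_chart sF' ad ae dp ep.
have E0 : (cfwd d \o F \o cbwd c) (cfwd c p) = cfwd d (F p) by rewrite /= cfwdK.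
rewrite -E0 in D2.
have J := jacobian_comp D1 D2; rewrite E0 in J.
(* Inserting [cbwd d \o cfwd d] between the two maps is harmless only where [F] takes values in the
   domain of [d], hence near the point. *)
apply: etrans _ J; apply/esym; apply: near_eq_jacobian; first exact: differentiable_comp D1 D2.
have FF : nbhs p (F @^-1` cdom d) by apply: sF.1; exact: near_cdom.
have := near_chart cp FF.
by apply: filterS => x [_ dx] /=; rewrite cfwdK.
Qed.

Lemma jac_id c p : cdom c p -> jac id c c p = 1%:M.
Proof.
move=> cp; have did : differentiable (@id 'rV[R]_n) (cfwd c p) by [].
apply: etrans (jacobian_id (cfwd c p)); apply/esym/(near_eq_jacobian did).
by have := near_chart cp (near_cdom cp); apply: filterS => x [cx _] /=; rewrite cbwdK.
Qed.

Lemma curve_chart F c d (gamma : R -> M) (t : R) (v : 'rV[R]_n) :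
  smooth_map F -> atlas c -> atlas d -> cdom c (gamma t) -> cdom d (F (gamma t)) ->
  {for t, continuous gamma} -> is_derive t 1 (cfwd c \o gamma) v ->
  is_derive t 1 (cfwd d \o F \o gamma) (v *m jac F c d (gamma t)).
Proof.
move=> sF ac ad cp dp cg [/derivable1_diffP D Ev].
have DF := smooth_map_chart sF ac ad cp dp.
have DE : differentiable ((cfwd d \o F \o cbwd c) \o (cfwd c \o gamma)) t.
  exact: differentiable_comp D DF.
have E : is_derive t 1 ((cfwd d \o F \o cbwd c) \o (cfwd c \o gamma))
    (v *m jac F c d (gamma t)).
  split; first exact: diff_derivable DE.
  by rewrite (derive_chain _ D DF) Ev (deriveEjacobian _ DF).
apply: near_eq_is_derive E.
have H : \forall s \near t, cdom c (gamma s) := cg _ (near_cdom cp).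
by move: H; apply: filterS => s /= cs; rewrite cfwdK.
Qed.

End Manifold.

(** * Left-invariant metrics *)

Section LieGroup.
Variables (R : realType) (n : nat) (G : lieGroupType R n) (h : pseudo_metric G).
Hypothesis h_bi : bi_invariant h.
Variable c0 : chart R n G.
Hypothesis ac0 : atlas c0.
Hypothesis c01 : cdom c0 (1%g : G).
Implicit Types (c d e : chart R n G) (a p q : G).

Lemma isometry_jac (g : pseudo_metric G) (F : G -> G) c d p :
  metric_isometry g F -> atlas c -> atlas d -> cdom c p -> cdom d (F p) ->
  gmx g c p = jac F c d p *m gmx g d (F p) *m (jac F c d p)^T.
Proof. by move=> [_ H] ac ad cp dp; exact: H. Qed.

(** An isometry is in particular a diffeomorphism, so [h] itself provides the smoothness of
    translations. *)
Lemma smooth_left a : smooth_map (fun x : G => (a * x)%g).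
Proof. by have [[[]]] := h_bi.1 a. Qed.

Lemma smooth_right a : smooth_map (fun x : G => (x * a)%g).
Proof. by have [[[]]] := h_bi.2 a. Qed.

(** The rows are the values at [p] of the left-invariant fields extending the coordinate basis of
    [c0] at the unit; those of [rtrans] are the right-invariant ones. *)
Definition ltrans c p : 'M[R]_n := jac (fun q => p * q)%g c0 c 1%g.
Definition rtrans c p : 'M[R]_n := jac (fun q => q * p)%g c0 c 1%g.

Let H0 := gmx h c0 1%g.

Lemma ltrans_change c d p : atlas c -> atlas d -> cdom c p -> cdom d p ->
  ltrans d p = ltrans c p *m jac id c d p.
Proof.
move=> ac ad cp dp.
have := @jac_comp _ _ G (fun q => p * q)%g id c0 c d 1%g
  (smooth_left p) (@smooth_map_id _ _ G) ac0 ac ad c01.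
by rewrite /= mulg1; apply.
Qed.

Lemma rtrans_change c d p : atlas c -> atlas d -> cdom c p -> cdom d p ->
  rtrans d p = rtrans c p *m jac id c d p.
Proof.
move=> ac ad cp dp.
have := @jac_comp _ _ G (fun q => q * p)%g id c0 c d 1%g
  (smooth_right p) (@smooth_map_id _ _ G) ac0 ac ad c01.
by rewrite /= mul1g; apply.
Qed.

Lemma ltrans_left c d a p : atlas c -> atlas d -> cdom c p -> cdom d (a * p)%g ->
  ltrans d (a * p)%g = ltrans c p *m jac (fun q => a * q)%g c d p.
Proof.
move=> ac ad cp dp.
have := @jac_comp _ _ G (fun q => p * q)%g (fun q => a * q)%g c0 c d 1%g
  (smooth_left p) (smooth_left a) ac0 ac ad c01.
rewrite /= mulg1 => /(_ cp dp) <-; congr jac.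
by apply/funext => q /=; rewrite mulgA.
Qed.

Lemma rtrans_right c d a p : atlas c -> atlas d -> cdom c p -> cdom d (p * a)%g ->
  rtrans d (p * a)%g = rtrans c p *m jac (fun q => q * a)%g c d p.
Proof.
move=> ac ad cp dp.
have := @jac_comp _ _ G (fun q => q * p)%g (fun q => q * a)%g c0 c d 1%g
  (smooth_right p) (smooth_right a) ac0 ac ad c01.
rewrite /= mul1g => /(_ cp dp) <-; congr jac.
by apply/funext => q /=; rewrite mulgA.
Qed.

(** Associativity: both sides are the derivative at the unit of [q |-> a * q * p]. *)
Lemma ltrans_rtrans_comm c c' d a p : atlas c -> atlas c' -> atlas d ->
  cdom c a -> cdom c' p -> cdom d (a * p)%g ->
  ltrans c a *m jac (fun q => q * p)%g c d a =
  rtrans c' p *m jac (fun q => a * q)%g c' d p.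
Proof.
move=> ac ac' ad ca cp dap.
have := @jac_comp _ _ G (fun q => a * q)%g (fun q => q * p)%g c0 c d 1%g
  (smooth_left a) (smooth_right p) ac0 ac ad c01.
rewrite /= mulg1 => /(_ ca dap) /esym E1; apply: (etrans E1).
have := @jac_comp _ _ G (fun q => q * p)%g (fun q => a * q)%g c0 c' d 1%g
  (smooth_right p) (smooth_left a) ac0 ac' ad c01.
rewrite /= mul1g => /(_ cp dap); apply: etrans; congr jac.
by apply/funext => q /=; rewrite mulgA.
Qed.

Lemma ltrans_metric (g : pseudo_metric G) c p : left_invariant g -> atlas c -> cdom c p ->
  ltrans c p *m gmx g c p *m (ltrans c p)^T = gmx g c0 1%g.
Proof.
move=> lg ac cp; have := isometry_jac (lg p) ac0 ac c01.
by rewrite mulg1 => /(_ cp) ->.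
Qed.

Lemma rtrans_metric c p : atlas c -> cdom c p ->
  rtrans c p *m gmx h c p *m (rtrans c p)^T = H0.
Proof.
move=> ac cp; have := isometry_jac (h_bi.2 p) ac0 ac c01.
by rewrite mul1g => /(_ cp) E; rewrite /H0 E.
Qed.

Lemma H0_unit : H0 \in unitmx. Proof. exact: gmx_nondegenerate. Qed.
Lemma H0_sym : H0^T = H0. Proof. exact: gmx_sym. Qed.

(** A factor of the invertible Gram matrix [H0] is invertible, which spares differentiating the
    inverse translation. *)
Lemma ltrans_unit c p : atlas c -> cdom c p -> ltrans c p \in unitmx.
Proof.
move=> ac cp; have := H0_unit; rewrite /H0 -(ltrans_metric h_bi.1 ac cp).
by rewrite !unitmx_mul => /andP[/andP[]].
Qed.

Lemma rtrans_unit c p : atlas c -> cdom c p -> rtrans c p \in unitmx.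
Proof.
move=> ac cp; have := H0_unit; rewrite -(rtrans_metric ac cp).
by rewrite !unitmx_mul => /andP[/andP[]].
Qed.

(* Up to the factor [H0], the matrix of the adjoint action of [p]. *)
Definition adm c p : 'M[R]_n := rtrans c p *m gmx h c p *m (ltrans c p)^T.

Lemma gmx_change_jac (g : pseudo_metric G) c d p :
  atlas c -> atlas d -> cdom c p -> cdom d p ->
  gmx g c p = jac id c d p *m gmx g d p *m (jac id c d p)^T.
Proof. by move=> ac ad cp dp; exact: gmx_change. Qed.

(** The entries are scalar products of tangent vectors at [p], independent of coordinates. *)
Lemma adm_change c d p : atlas c -> atlas d -> cdom c p -> cdom d p ->
  adm c p = adm d p.
Proof.
move=> ac ad cp dp; rewrite /adm (ltrans_change ac ad cp dp) (rtrans_change ac ad cp dp).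
rewrite (gmx_change_jac h ac ad cp dp) trmx_mul.
by move: (ltrans c p) (rtrans c p) (jac _ _ _ _) (gmx _ _ _) => A B C D; rewrite !mulmxA.
Qed.

Lemma sandwich_inv (A B S : 'M[R]_n) : S \in unitmx -> A *m B *m A^T = S ->
  B *m A^T *m invmx S *m A = 1%:M.
Proof.
move=> Su E.
have Au : A \in unitmx by move: Su; rewrite -E !unitmx_mul => /andP[/andP[]].
have ES : A *m (B *m A^T *m invmx S) = 1%:M by rewrite !mulmxA E mulmxV.
exact: mulmx1C ES.
Qed.

(** Left and right invariance of [h] give both frames at [p] the Gram matrix [H0], so the matrix
    between them preserves the form [H0]. *)
Lemma adm_orthogonal c p : atlas c -> cdom c p ->
  adm c p *m invmx H0 *m (adm c p)^T = H0.
Proof.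
move=> ac cp; have := ltrans_metric h_bi.1 ac cp; rewrite -/H0.
have := rtrans_metric ac cp.
have hs := gmx_sym h ac cp.
rewrite /adm.
move: (ltrans c p) (rtrans c p) (gmx h c p) hs => A B C CT EB EA.
have := sandwich_inv H0_unit EA.
rewrite !trmx_mul !trmxK CT => E.
have -> : B *m C *m A^T *m invmx H0 *m (A *m (C *m B^T)) =
   B *m (C *m A^T *m invmx H0 *m A) *m C *m B^T by rewrite !mulmxA.
by rewrite E mulmx1.
Qed.

(** The homomorphism property of the adjoint action, whose matrix is [adm] times [invmx H0]. It
    rests on exchanging a left and a right translation, by [ltrans_rtrans_comm]. *)
Lemma adm_mul c c' d a p : atlas c -> atlas c' -> atlas d ->
  cdom c a -> cdom c' p -> cdom d (a * p)%g ->
  adm d (a * p)%g = adm c a *m invmx H0 *m adm c' p.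
Proof.
move=> ac ac' ad ca cp dap.
have E1 := rtrans_right ac ad ca dap.
have E2 := ltrans_left ac' ad cp dap.
have E3 := ltrans_rtrans_comm ac ac' ad ca cp dap.
have E4 := isometry_jac (h_bi.1 a) ac' ad cp dap.
have E5 := sandwich_inv H0_unit (ltrans_metric h_bi.1 ac ca).
rewrite /adm E1 E2 E4 trmx_mul.
move: E3 E5; move: (ltrans c a) (rtrans c a) (ltrans c' p) (rtrans c' p) (jac _ c d a)
  (jac _ c' d p) (gmx h c a) (gmx h d _) => La Ra Lp Rp J1 J2 ha hd E3 E5.
have -> : Ra *m ha *m La^T *m invmx H0 *m (Rp *m (J2 *m hd *m J2^T) *m Lp^T) =
  Ra *m (ha *m La^T *m invmx H0) *m (Rp *m J2) *m hd *m (J2^T *m Lp^T).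
  by rewrite !mulmxA.
rewrite -E3.
have -> : Ra *m (ha *m La^T *m invmx H0) *m (La *m J1) *m hd *m (J2^T *m Lp^T) =
  Ra *m (ha *m La^T *m invmx H0 *m La) *m J1 *m hd *m (J2^T *m Lp^T).
  by rewrite !mulmxA.
by rewrite E5 mulmx1 !mulmxA.
Qed.

Variable B : 'M[R]_n.
Hypothesis B_sym : B^T = B.
Hypothesis B_unit : B \in unitmx.

(** Invariance of [h] gives [gmx h c p *m (ltrans c p)^T *m invmx H0] as the inverse of
    [ltrans c p]. This is thus [B] transported from the unit, written as a product of smooth factors
    with no inverse depending on [p]. *)
Definition lmetric_mx c p : 'M[R]_n :=
  gmx h c p *m (ltrans c p)^T *m invmx H0 *m B *m invmx H0 *m ltrans c p *m gmx h c p.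

Lemma lmetric_mxE c p : atlas c -> cdom c p ->
  ltrans c p *m lmetric_mx c p *m (ltrans c p)^T = B.
Proof.
move=> ac cp; have := ltrans_metric h_bi.1 ac cp; rewrite -/H0 /lmetric_mx.
move: (ltrans c p) (gmx h c p) => L g E.
have -> : L *m (g *m L^T *m invmx H0 *m B *m invmx H0 *m L *m g) *m L^T =
  (L *m g *m L^T) *m invmx H0 *m B *m (invmx H0 *m (L *m g *m L^T)) by rewrite !mulmxA.
by rewrite E mulmxV ?H0_unit// mul1mx mulVmx ?H0_unit// mulmx1.
Qed.

Lemma mulmx_trmx_inj (L X Y : 'M[R]_n) : L \in unitmx ->
  L *m X *m L^T = L *m Y *m L^T -> X = Y.
Proof.
move=> Lu E; have LTu : L^T \in unitmx by rewrite unitmx_tr.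
by rewrite -[X](mulKmx Lu) -[L *m X](mulmxK LTu) E (mulmxK LTu) (mulKmx Lu).
Qed.

(** Pulled back to the unit by [ltrans], both sides are [B]; [lmetric_change] follows in the same
    way. *)
Lemma lmetric_left c d a p : atlas c -> atlas d -> cdom c p -> cdom d (a * p)%g ->
  let J := jac (fun q => a * q)%g c d p in
  lmetric_mx c p = J *m lmetric_mx d (a * p)%g *m J^T.
Proof.
move=> ac ad cp dap J; apply: (mulmx_trmx_inj (ltrans_unit ac cp)).
apply: etrans (lmetric_mxE ac cp) _; apply: etrans (esym (lmetric_mxE ad dap)) _.
rewrite (ltrans_left ac ad cp dap) trmx_mul -/J.
by move: (lmetric_mx _ _) (ltrans _ _) J => X Y J; rewrite !mulmxA.
Qed.

Lemma lmetric_change c d p : atlas c -> atlas d -> cdom c p -> cdom d p ->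
  let J := 'J (cfwd d \o cbwd c) (cfwd c p) in
  lmetric_mx c p = J *m lmetric_mx d p *m J^T.
Proof.
move=> ac ad cp dp J; apply: (mulmx_trmx_inj (ltrans_unit ac cp)).
apply: etrans (lmetric_mxE ac cp) _; apply: etrans (esym (lmetric_mxE ad dp)) _.
rewrite (ltrans_change ac ad cp dp) trmx_mul -[jac id c d p]/J.
by move: (lmetric_mx _ _) (ltrans _ _) J => X Y J; rewrite !mulmxA.
Qed.

Lemma lmetric_sym c p : atlas c -> cdom c p -> (lmetric_mx c p)^T = lmetric_mx c p.
Proof.
move=> ac cp; apply: (mulmx_trmx_inj (ltrans_unit ac cp)).
rewrite lmetric_mxE// -[RHS]B_sym -(lmetric_mxE ac cp).
by move: (lmetric_mx _ _) (ltrans _ _) => X Y; rewrite !trmx_mul trmxK mulmxA.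
Qed.

Lemma lmetric_unit c p : atlas c -> cdom c p -> lmetric_mx c p \in unitmx.
Proof.
move=> ac cp; move: B_unit; rewrite -(lmetric_mxE ac cp).
by rewrite !unitmx_mul => /andP[/andP[]].
Qed.

Definition pmul c d e (uv : 'rV[R]_n * 'rV[R]_n) : 'rV[R]_n :=
  cfwd e (cbwd c uv.1 * cbwd d uv.2)%g.

Definition pmul_dom c d e : set ('rV[R]_n * 'rV[R]_n) :=
  [set uv | [/\ cimg c uv.1, cimg d uv.2 & cdom e (cbwd c uv.1 * cbwd d uv.2)%g]].

Lemma pmul_smooth c d e : atlas c -> atlas d -> atlas e ->
  smooth_on (pmul_dom c d e) (pmul c d e).
Proof. exact: mulg_smooth. Qed.

Lemma pmul_dom_open c d e : open (pmul_dom c d e).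
Proof.
rewrite openE => uv [cu dv euv].
have C : {for uv, continuous (fun uv : 'rV[R]_n * 'rV[R]_n => (cbwd c uv.1 * cbwd d uv.2)%g)}.
  have C1 : {for uv, continuous (fun uv : 'rV[R]_n * 'rV[R]_n => (cbwd c uv.1, cbwd d uv.2))}.
    apply: cvg_pair => /=.
      have H1 : {for uv, continuous (fst : 'rV[R]_n * 'rV[R]_n -> _)} by exact: cvg_fst.
      exact: (continuous_comp H1 (cbwd_continuous cu)).
    have H2 : {for uv, continuous (snd : 'rV[R]_n * 'rV[R]_n -> _)} by exact: cvg_snd.
    exact: (continuous_comp H2 (cbwd_continuous dv)).
  exact: (continuous_comp C1 (@mulg_continuous _ _ G (_, _))).
have N1 : \forall w \near uv, cimg c w.1.
  have H1 : {for uv, continuous (fst : 'rV[R]_n * 'rV[R]_n -> _)} by exact: cvg_fst.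
  by apply: H1; apply: open_nbhs_nbhs; split; [exact: open_cimg|].
have N2 : \forall w \near uv, cimg d w.2.
  have H1 : {for uv, continuous (snd : 'rV[R]_n * 'rV[R]_n -> _)} by exact: cvg_snd.
  by apply: H1; apply: open_nbhs_nbhs; split; [exact: open_cimg|].
have N3 : \forall w \near uv, cdom e (cbwd c w.1 * cbwd d w.2)%g.
  exact: (C _ (near_cdom euv)).
by move: N1 N2 N3; rewrite /interior /=; apply: filterS3 => w; split.
Qed.

Let x0 := cfwd c0 1%g.

Lemma pmul_dom_l c p : cdom c p -> pmul_dom c c0 c (cfwd c p, x0).
Proof.
by move=> cp; split => /=; [exact: cfwd_img|exact: cfwd_img|rewrite !cfwdK// mulg1].
Qed.

Lemma pmul_dom_r c p : cdom c p -> pmul_dom c0 c c (x0, cfwd c p).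
Proof.
by move=> cp; split => /=; [exact: cfwd_img|exact: cfwd_img|rewrite !cfwdK// mul1g].
Qed.

Lemma pair_l_affine (y : 'rV[R]_n) (k : R) (v x : 'rV[R]_n) :
  (k *: v + x, y) = k *: (v, 0) + (x, y) :> 'rV[R]_n * 'rV[R]_n.
Proof. by congr (_, _); rewrite /= scaler0 add0r. Qed.

Lemma pair_r_affine (y : 'rV[R]_n) (k : R) (v x : 'rV[R]_n) :
  (y, k *: v + x) = k *: (0, v) + (y, x) :> 'rV[R]_n * 'rV[R]_n.
Proof. by congr (_, _); rewrite /= scaler0 add0r. Qed.

Lemma differentiable_pair_l (y x : 'rV[R]_n) :
  differentiable (fun x : 'rV[R]_n => (x, y)) x.
Proof. by apply: differentiable_pair => //; exact: differentiable_cst. Qed.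

Lemma differentiable_pair_r (y x : 'rV[R]_n) :
  differentiable (fun x : 'rV[R]_n => (y, x)) x.
Proof. by apply: differentiable_pair => //; exact: differentiable_cst. Qed.

(** In this form [p] enters only through the point where a fixed partial derivative of the
    multiplication is taken, so smoothness in [p] comes from [mulg_smooth]. *)
Lemma ltrans_derive c p i j : atlas c -> cdom c p ->
  ltrans c p i j =
  'D_((0, delta_mx 0 i) : 'rV[R]_n * 'rV[R]_n) (pmul c c0 c) (cfwd c p, x0) 0 j.
Proof.
move=> ac cp.
have D : differentiable (cfwd c \o (fun q => p * q)%g \o cbwd c0) x0.
  by apply: (smooth_map_chart (smooth_left p) ac0 ac c01); rewrite mulg1.
have E : (cfwd c \o (fun q => p * q)%g \o cbwd c0) = pmul c c0 c \o (fun y => (cfwd c p, y)).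
  by apply/funext => y; rewrite /pmul /= cfwdK.
apply: etrans (jacobianE i j D) _; congr (fun_of_matrix _ 0 j).
rewrite E; exact: (derive_affine (pair_r_affine (cfwd c p))).
Qed.

Lemma rtrans_derive c p i j : atlas c -> cdom c p ->
  rtrans c p i j =
  'D_((delta_mx 0 i, 0) : 'rV[R]_n * 'rV[R]_n) (pmul c0 c c) (x0, cfwd c p) 0 j.
Proof.
move=> ac cp.
have D : differentiable (cfwd c \o (fun q => q * p)%g \o cbwd c0) x0.
  by apply: (smooth_map_chart (smooth_right p) ac0 ac c01); rewrite mul1g.
have E : (cfwd c \o (fun q => q * p)%g \o cbwd c0) = pmul c0 c c \o (fun y => (y, cfwd c p)).
  by apply/funext => y; rewrite /pmul /= cfwdK.
apply: etrans (jacobianE i j D) _; congr (fun_of_matrix _ 0 j).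
rewrite E; exact: (derive_affine (pair_l_affine (cfwd c p))).
Qed.

Lemma ltrans_smooth c : atlas c -> smooth_on (cimg c) (ltrans c \o cbwd c).
Proof.
move=> ac k; apply/Ck_on_mxP => [|i j]; first exact: open_cimg.
have S := smooth_on_derive ((0, delta_mx 0 i) : 'rV[R]_n * 'rV[R]_n) (pmul_smooth ac ac0 ac) k.
have S2 : Ck_on k (cimg c)
    ('D_((0, delta_mx 0 i) : 'rV[R]_n * 'rV[R]_n) (pmul c c0 c) \o (fun x => (x, x0))).
  apply: (Ck_on_affine (pair_l_affine x0)) S; first exact: differentiable_pair_l.
  by move=> x cx; have := pmul_dom_l (cbwd_dom cx); rewrite cbwdK.
have oc : open (cimg c) by exact: open_cimg.
have /Ck_on_mxP := S2 => /(_ oc 0 j).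
apply: Ck_on_eq; first exact: open_cimg.
move=> x /set_mem cx /=; rewrite (ltrans_derive _ _ ac (cbwd_dom cx)).
by rewrite (cbwdK cx).
Qed.

Lemma rtrans_smooth c : atlas c -> smooth_on (cimg c) (rtrans c \o cbwd c).
Proof.
move=> ac k; apply/Ck_on_mxP => [|i j]; first exact: open_cimg.
have S := smooth_on_derive ((delta_mx 0 i, 0) : 'rV[R]_n * 'rV[R]_n) (pmul_smooth ac0 ac ac) k.
have S2 : Ck_on k (cimg c)
    ('D_((delta_mx 0 i, 0) : 'rV[R]_n * 'rV[R]_n) (pmul c0 c c) \o (fun x => (x0, x))).
  apply: (Ck_on_affine (pair_r_affine x0)) S; first exact: differentiable_pair_r.
  by move=> x cx; have := pmul_dom_r (cbwd_dom cx); rewrite cbwdK.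
have oc : open (cimg c) by exact: open_cimg.
have /Ck_on_mxP := S2 => /(_ oc 0 j).
apply: Ck_on_eq; first exact: open_cimg.
move=> x /set_mem cx /=; rewrite (rtrans_derive _ _ ac (cbwd_dom cx)).
by rewrite (cbwdK cx).
Qed.

Lemma lmetric_smooth c : atlas c -> smooth_on (cimg c) (lmetric_mx c \o cbwd c).
Proof.
move=> ac k; have oc : open (cimg c) by exact: open_cimg.
have Sh := gmx_smooth h ac k; have SL := ltrans_smooth ac k.
have Sc (A : 'M[R]_n) := Ck_on_cst k (cimg c) A.
have := Ck_on_mulmx oc (Ck_on_mulmx oc (Ck_on_mulmx oc (Ck_on_mulmx oc
  (Ck_on_mulmx oc (Ck_on_mulmx oc Sh (Ck_on_trmx oc SL)) (Sc (invmx H0)))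
  (Sc B)) (Sc (invmx H0))) SL) Sh.
exact.
Qed.

Definition lmetric : pseudo_metric G :=
  @Defs.PseudoMetric R n G lmetric_mx lmetric_sym lmetric_unit lmetric_smooth lmetric_change.

Lemma lmetric_left_invariant : left_invariant lmetric.
Proof.
move=> a; split; first exact: (h_bi.1 a).1.
by move=> c d p ac ad cp dp; exact: lmetric_left.
Qed.

End LieGroup.

(** * Noether's theorem *)

Section MatrixDerive.
Variables (R : realType) (V : normedModType R).

Lemma derive_mx_entry m n (F : V -> 'M[R]_(m, n)) x v i j :
  differentiable F x -> 'D_v F x i j = 'D_v (fun y => F y i j) x.
Proof. by move=> dF; rewrite (derive_mx (diff_derivable dF)) mxE. Qed.

Lemma is_derive_mxP m n (F : V -> 'M[R]_(m, n)) x v (D : 'M[R]_(m, n)) :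
  (forall i j, is_derive x v (fun y => F y i j) (D i j)) -> is_derive x v F D.
Proof.
move=> H; have dF : derivable F x v by apply/derivable_mxP => i j; have [] := H i j.
split=> //; rewrite (derive_mx dF); apply/matrixP => i j; rewrite mxE.
by have [] := H i j.
Qed.

Lemma is_derive_entry m n (F : V -> 'M[R]_(m, n)) x v (D : 'M[R]_(m, n)) i j :
  is_derive x v F D -> is_derive x v (fun y => F y i j) (D i j).
Proof.
move=> [dF <-]; split; first exact: (derivable_mxP _ _ _).1.
by rewrite (derive_mx dF) mxE.
Qed.

Lemma is_derive_mulmx m n p (A : V -> 'M[R]_(m, n)) (B : V -> 'M[R]_(n, p)) x v dA dB :
  is_derive x v A dA -> is_derive x v B dB ->
  is_derive x v (fun y => A y *m B y) (dA *m B x + A x *m dB).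
Proof.
move=> HA HB; apply: is_derive_mxP => i j.
have -> : (fun y => (A y *m B y) i j) =
    \sum_k ((fun y => A y i k) * (fun y => B y k j)).
  by apply/funext => y; rewrite mxE fct_sumE.
have H k : is_derive x v ((fun y => A y i k) * (fun y => B y k j))
    (A x i k * dB k j + B x k j * dA i k).
  by apply: is_deriveM; exact: is_derive_entry.
have -> : (dA *m B x + A x *m dB) i j = \sum_k (A x i k * dB k j + B x k j * dA i k).
  by rewrite !mxE -big_split; apply: eq_bigr => k _; rewrite addrC [dA i k * _]mulrC.
exact: is_derive_sum.
Qed.

Lemma is_derive_trmx m n (A : V -> 'M[R]_(m, n)) x v dA :
  is_derive x v A dA -> is_derive x v (fun y => (A y)^T) dA^T.
Proof.
move=> HA; apply: is_derive_mxP => i j; rewrite mxE.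
under eq_fun do rewrite mxE.
exact: is_derive_entry.
Qed.

End MatrixDerive.


Section Noether.
Variables (R : realType) (n : nat) (G : lieGroupType R n) (h : pseudo_metric G).
Hypothesis h_bi : bi_invariant h.
Variable c0 : chart R n G.
Hypothesis ac0 : atlas c0.
Hypothesis c01 : cdom c0 (1%g : G).
Variable g : pseudo_metric G.
Hypothesis lg : left_invariant g.
Variable c : chart R n G.
Hypothesis ac : atlas c.

Let gm x := gmx g c (cbwd c x).
Let rt x := rtrans c0 c (cbwd c x).
Let x0 := cfwd c0 1%g.
Let mu := pmul c0 c c.

Let oc : open (cimg c). Proof. exact: open_cimg. Qed.

Lemma jac_left_derive (y x : 'rV[R]_n) i k : pmul_dom c0 c c (y, x) ->
  jac (fun q => cbwd c0 y * q)%g c c (cbwd c x) i k =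
  'D_((0, delta_mx 0 i) : 'rV[R]_n * 'rV[R]_n) mu (y, x) 0 k.
Proof.
move=> [/= cy cx cyx].
have D : differentiable (cfwd c \o (fun q => cbwd c0 y * q)%g \o cbwd c) (cfwd c (cbwd c x)).
  by apply: (smooth_map_chart (smooth_left h_bi _) ac ac); [exact: cbwd_dom|].
have E : (cfwd c \o (fun q => cbwd c0 y * q)%g \o cbwd c) = mu \o (fun x => (y, x)).
  by [].
apply: etrans (jacobianE i k D) _; congr (fun_of_matrix _ 0 k).
rewrite E cbwdK//; exact: (derive_affine (pair_r_affine y)).
Qed.

Lemma mu_smooth : smooth_on (pmul_dom c0 c c) mu.
Proof. exact: pmul_smooth. Qed.

Lemma pmul_dom_unit (x : 'rV[R]_n) : cimg c x -> pmul_dom c0 c c (x0, x).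
Proof. by move=> cx; have := pmul_dom_r c01 (cbwd_dom cx); rewrite cbwdK. Qed.

Lemma mu_unit (x : 'rV[R]_n) : cimg c x -> mu (x0, x) = x.
Proof. by move=> cx; rewrite /mu /pmul /= cfwdK// mul1g cbwdK. Qed.

Lemma rt_row (x : 'rV[R]_n) al : cimg c x ->
  row al (rt x) = 'D_((delta_mx 0 al, 0) : 'rV[R]_n * 'rV[R]_n) mu (x0, x).
Proof.
move=> cx; apply/rowP => j; rewrite mxE /rt (rtrans_derive h_bi ac0 c01 _ _ ac (cbwd_dom cx)).
by rewrite (cbwdK cx).
Qed.

Lemma gm_smooth : smooth_on (cimg c) gm. Proof. exact: gmx_smooth. Qed.
Lemma rt_smooth : smooth_on (cimg c) rt. Proof. exact: (rtrans_smooth h_bi ac0 c01 ac). Qed.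

(* By the symmetry of the second derivatives of [mu]. *)
Lemma is_derive_jac_left (x : 'rV[R]_n) al : cimg c x ->
  is_derive x0 (delta_mx 0 al : 'rV[R]_n)
    (fun y => jac (fun q => cbwd c0 y * q)%g c c (cbwd c x))
    (\matrix_(i, k) 'D_(delta_mx 0 i) rt x al k).
Proof.
move=> cx; have Ux := pmul_dom_unit cx.
have oU := @pmul_dom_open _ _ G c0 c c.
apply: is_derive_mxP => i k; rewrite mxE.
pose ei : 'rV[R]_n * 'rV[R]_n := (0, delta_mx 0 i).
pose ea : 'rV[R]_n * 'rV[R]_n := (delta_mx 0 al, 0).
have Ck : Ck_on 2 (pmul_dom c0 c c) (fun uv => mu uv 0 k).
  by have /Ck_on_mxP := mu_smooth 2 => /(_ oU 0 k).
have dmu w : pmul_dom c0 c c w -> differentiable mu w.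
  exact: smooth_on_differentiable mu_smooth.
have Dk v w : pmul_dom c0 c c w -> 'D_v mu w 0 k = 'D_v (fun uv => mu uv 0 k) w.
  by move=> Uw; exact: derive_mx_entry (dmu _ Uw).
have E : is_derive x0 (delta_mx 0 al : 'rV[R]_n)
    ('D_ei (fun uv => mu uv 0 k) \o (fun y => (y, x)))
    ('D_ea ('D_ei (fun uv => mu uv 0 k)) (x0, x)).
  split; last exact: (derive_affine (pair_l_affine x)).
  apply: diff_derivable; apply: differentiable_comp; first exact: differentiable_pair_l.
  by have [_ /(_ ei) [+ _]] := Ck; apply.
have -> : 'D_(delta_mx 0 i) rt x al k = 'D_ea ('D_ei (fun uv => mu uv 0 k)) (x0, x).
  apply: etrans _ (derive_comm _ _ oU Ux Ck).
  apply: etrans _ (derive_affine (pair_r_affine x0) _ _ _).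
  apply: etrans (derive_mx_entry _ _ _ (smooth_on_differentiable rt_smooth cx)) _.
  apply: near_eq_derive; apply: (open_near_eq oc cx) => z /set_mem cz.
  have := rt_row al cz => /rowP/(_ k); rewrite mxE => ->.
  by apply: Dk; exact: pmul_dom_unit.
apply: near_eq_is_derive E.
have N : \forall y \near x0, pmul_dom c0 c c (y, x).
  have H1 : {for x0, continuous (fun y : 'rV[R]_n => (y, x))}.
    exact/differentiable_continuous/differentiable_pair_l.
  exact: (H1 _ (open_nbhs_nbhs (conj oU Ux))).
move: N; apply: filterS => y Uy /=; rewrite (jac_left_derive _ _ Uy).
by apply/esym; exact: Dk.
Qed.

(* Differentiates the invariance of [g] under left translations at the unit: the
   right-invariant vector fields are Killing fields of [g]. *)
Lemma killing (x : 'rV[R]_n) al : cimg c x ->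
  let D := \matrix_(i, k) 'D_(delta_mx 0 i) rt x al k in
  D *m gm x + 'D_(row al (rt x)) gm x + gm x *m D^T = 0.
Proof.
move=> cx D; have Ux := pmul_dom_unit cx.
have oU := @pmul_dom_open _ _ G c0 c c.
pose J y := jac (fun q => cbwd c0 y * q)%g c c (cbwd c x).
have dJ : is_derive x0 (delta_mx 0 al : 'rV[R]_n) J D by exact: is_derive_jac_left.
have J1 : J x0 = 1%:M.
  apply: etrans _ (jac_id (cbwd_dom cx)); rewrite /J (cfwdK c01); congr jac.
  by apply/funext => q; rewrite mul1g.
have dmu : differentiable mu (x0, x) by exact: smooth_on_differentiable mu_smooth Ux.
have dmuy : differentiable (mu \o (fun y => (y, x))) x0.
  by apply: differentiable_comp; first exact: differentiable_pair_l.
have dgm : differentiable gm x by exact: smooth_on_differentiable gm_smooth cx.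
have mux : (mu \o (fun y => (y, x))) x0 = x by exact: mu_unit.
have dG : is_derive x0 (delta_mx 0 al : 'rV[R]_n) (gm \o (mu \o (fun y => (y, x))))
    ('D_(row al (rt x)) gm x).
  split; first by apply/diff_derivable/differentiable_comp => //; rewrite mux.
  apply: etrans (derive_chain _ dmuy _) _; first by rewrite mux.
  rewrite mux (rt_row al cx); congr derive.
  exact: (derive_affine (pair_l_affine x)).
have F := is_derive_mulmx (is_derive_mulmx dJ dG) (is_derive_trmx dJ).
have F0 : is_derive x0 (delta_mx 0 al : 'rV[R]_n) (fun=> gm x) (0 : 'M[R]_n).
  exact: is_derive_cst.
have N : \forall y \near x0, gm x = J y *m (gm \o (mu \o (fun y => (y, x)))) y *m (J y)^T.
  have H1 : {for x0, continuous (fun y : 'rV[R]_n => (y, x))}.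
    exact/differentiable_continuous/differentiable_pair_l.
  have N : \forall y \near x0, pmul_dom c0 c c (y, x) := H1 _ (open_nbhs_nbhs (conj oU Ux)).
  move: N; apply: filterS => y [/= cy _ cyx].
  rewrite /gm /mu /pmul /= (cfwdK cyx).
  exact: (isometry_jac (lg (cbwd c0 y)) ac ac (cbwd_dom cx) cyx).
have [_ E1] := near_eq_is_derive N F0.
have [_ E2] := F.
have E3 := etrans (esym E1) E2.
move: E3; rewrite J1 /= (mu_unit cx : mu (x0, x) = x) trmx1 !mul1mx mulmx1 => E3.
by rewrite -E3.
Qed.

(* The Euler-Lagrange covector of the energy [v *m gm x *m v^T / 2] along a curve with
   position [x], velocity [v] and acceleration [a]. *)
Definition el (x v a : 'rV[R]_n) : 'rV[R]_n :=
  a *m gm x + v *m 'D_v gm x -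
  2^-1 *: \row_m (v *m 'D_(delta_mx 0 m : 'rV[R]_n) gm x *m v^T) 0 0.

Lemma is_derive_comp_curve m p (f : 'rV[R]_m -> 'M[R]_(p, n)) (x : R -> 'rV[R]_m) (t : R) v :
  differentiable f (x t) -> is_derive t 1 x v -> is_derive t 1 (f \o x) ('D_v f (x t)).
Proof.
move=> df [/derivable1_diffP dx Ev]; split.
  apply: diff_derivable; exact: differentiable_comp dx df.
by apply: etrans (derive_chain _ dx df) _; rewrite Ev.
Qed.

Lemma gm_sym (x : 'rV[R]_n) : cimg c x -> (gm x)^T = gm x.
Proof. by move=> cx; apply: gmx_sym => //; exact: cbwd_dom. Qed.

Lemma mx11_trmx (A : 'M[R]_1) : A^T = A.
Proof. by apply/matrixP => i j; rewrite mxE !ord1. Qed.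

(** The Killing equation is evaluated on [v] twice: its two outer terms are transposes of each
    other, hence equal as 1 by 1 matrices. *)
Lemma killing_quadratic (x v : 'rV[R]_n) al : cimg c x ->
  (v *m gm x *m ('D_v rt x)^T) 0 al =
  - (2^-1 * (v *m 'D_(row al (rt x)) gm x *m v^T) 0 0).
Proof.
move=> cx; have K := killing al cx.
set D := \matrix_(i, k) _ in K.
have dr := smooth_on_differentiable rt_smooth cx.
have E : row al ('D_v rt x) = v *m D.
  apply/rowP => k; rewrite mxE (derive_rV_sum _ dr) summxE mxE.
  by apply: eq_bigr => i _; rewrite !mxE.
have -> : (v *m gm x *m ('D_v rt x)^T) 0 al = (v *m gm x *m D^T *m v^T) 0 0.
  rewrite -[in RHS]mulmxA -trmx_mul -E.
  by rewrite [LHS]mxE [RHS]mxE; apply: eq_bigr => k _; rewrite !mxE.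
clear E; move: K (gm_sym cx); move: (gm x) D ('D_(row al (rt x)) gm x) => g' D DG K gs.
have A : v *m D *m g' *m v^T = v *m g' *m D^T *m v^T.
  by rewrite -[LHS]mx11_trmx !trmx_mul trmxK gs !mulmxA.
have : (v *m (D *m g' + DG + g' *m D^T) *m v^T) 0 0 = 0.
  by rewrite K mulmx0 mul0mx mxE.
rewrite !mulmxDr !mulmxDl !mulmxA A mxE [X in X + _]mxE.
set X := (v *m g' *m D^T *m v^T) 0 0; set Y := (v *m DG *m v^T) 0 0.
by lra.
Qed.

(** Rewrites the variation of the right-invariant frame along [v] as the gradient term of [el],
    which is what [noether] needs. *)
Lemma killing_row (x v : 'rV[R]_n) : cimg c x ->
  v *m gm x *m ('D_v rt x)^T =
  - (2^-1 *: \row_m (v *m 'D_(delta_mx 0 m : 'rV[R]_n) gm x *m v^T) 0 0) *m (rt x)^T.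
Proof.
move=> cx; have dg := smooth_on_differentiable gm_smooth cx.
set Q := \row_m _; apply/rowP => al; apply: (etrans (killing_quadratic v al cx)).
have -> : (v *m 'D_(row al (rt x)) gm x *m v^T) 0 0 = (Q *m (rt x)^T) 0 al.
  rewrite (derive_rV_sum _ dg) mulmx_sumr mulmx_suml summxE [RHS]mxE.
  apply: eq_bigr => m _; rewrite -scalemxAr -scalemxAl [LHS]mxE [in RHS]mxE.
  have -> : row al (rt x) 0 m = (rt x)^T m al by rewrite !mxE.
  exact: mulrC.
by move: Q (rt x)^T => Q r; rewrite mulNmx -scalemxAl !mxE.
Qed.

(** In the product rule, differentiating [v] and [gm] gives the first two terms of [el];
    differentiating the frame gives the third, by [killing_row]. *)
Lemma noether (x v : R -> 'rV[R]_n) (t : R) (a : 'rV[R]_n) : cimg c (x t) ->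
  is_derive t 1 x (v t) -> is_derive t 1 v a ->
  is_derive t 1 (fun s => v s *m gm (x s) *m (rt (x s))^T)
    (el (x t) (v t) a *m (rt (x t))^T).
Proof.
move=> cx Dx Dv.
have dg := smooth_on_differentiable gm_smooth cx.
have dr := smooth_on_differentiable rt_smooth cx.
have Dg := is_derive_comp_curve dg Dx.
have Dr := is_derive_comp_curve dr Dx.
apply: is_derive_eq (is_derive_mulmx (is_derive_mulmx Dv Dg) (is_derive_trmx Dr)) _.
rewrite /el mulmxBl; congr (_ + _).
by rewrite -mulNmx; exact: killing_row.
Qed.

(** Paired with the velocity, the gradient term of [el] becomes half of [v *m 'D_v gm x *m v^T], and
    the symmetry of [gm] merges the two acceleration terms. *)
Lemma energy_derive (x v : R -> 'rV[R]_n) (t : R) (a : 'rV[R]_n) : cimg c (x t) ->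
  is_derive t 1 x (v t) -> is_derive t 1 v a ->
  is_derive t 1 (fun s => v s *m gm (x s) *m (v s)^T) (2 *: (el (x t) (v t) a *m (v t)^T)).
Proof.
move=> cx Dx Dv.
have dg := smooth_on_differentiable gm_smooth cx.
have Dg := is_derive_comp_curve dg Dx.
apply: is_derive_eq (is_derive_mulmx (is_derive_mulmx Dv Dg) (is_derive_trmx Dv)) _.
have E : (\row_m (v t *m 'D_(delta_mx 0 m : 'rV[R]_n) gm (x t) *m (v t)^T) 0 0) *m (v t)^T =
    v t *m 'D_(v t) gm (x t) *m (v t)^T.
  apply/matrixP => i j; rewrite !ord1 (derive_rV_sum _ dg).
  rewrite mulmx_sumr mulmx_suml summxE [LHS]mxE.
  apply: eq_bigr => m _; rewrite -scalemxAr -scalemxAl [RHS]mxE.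
  have -> : (v t)^T m 0 = v t 0 m by rewrite mxE.
  by rewrite mulrC; congr (_ * _); rewrite [LHS]mxE.
rewrite /el mulmxBl mulmxDl -scalemxAl E.
rewrite -[v t *m _ *m a^T]mx11_trmx !trmx_mul trmxK (gm_sym cx) mulmxA.
move: (a *m _ *m _) (v t *m _ *m _) => X Y.
by apply/matrixP => i j; rewrite !mxE; field.
Qed.

(** Multiplication by [gm x] lowers the index of the geodesic equation. The first two derivatives in
    the Christoffel symbols contribute equally, which cancels the factor 1/2; the third gives the
    gradient term. *)
Lemma el_christoffel (x v a : 'rV[R]_n) : cimg c x ->
  let z := \row_k (a 0 k +
    \sum_(i < n) \sum_(j < n) christoffel g c i j k x * v 0 i * v 0 j) in
  z *m gm x = el x v a.
Proof.
move=> cx z; have gu : gm x \in unitmx by apply: gmx_nondegenerate => //; exact: cbwd_dom.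
have gs := gm_sym cx.
have dg := smooth_on_differentiable gm_smooth cx.
pose S i j l := partial i (gcoord g c j l) x + partial j (gcoord g c i l) x
     - partial l (gcoord g c i j) x.
pose w : 'rV[R]_n := \row_l \sum_i \sum_j S i j l * v 0 i * v 0 j.
have zE : z = a + 2^-1 *: (w *m invmx (gm x)).
  apply/rowP => k; rewrite !mxE; congr (_ + _).
  transitivity (2^-1 * \sum_l \sum_i \sum_j (S i j l * v 0 i * v 0 j) * invmx (gm x) k l).
    rewrite [in RHS]exchange_big mulr_sumr; apply: eq_bigr => i _.
    rewrite [in RHS]exchange_big mulr_sumr; apply: eq_bigr => j _.
    rewrite /christoffel -/(gm x) -!mulrA; congr (_ * _); rewrite mulr_suml.
    by apply: eq_bigr => l _; rewrite -/(S i j l); ring.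
  congr (_ * _); apply: eq_bigr => l _; rewrite mxE mulr_suml.
  have -> : invmx (gm x) l k = invmx (gm x) k l by rewrite -{1}gs -trmx_inv mxE.
  by apply: eq_bigr => i _; rewrite mulr_suml.
rewrite zE mulmxDl -scalemxAl (mulmxKV gu) /el -addrA; congr (_ + _).
have pE i j l : partial i (gcoord g c j l) x = 'D_(delta_mx 0 i : 'rV[R]_n) gm x j l.
  by apply/esym; exact: derive_mx_entry.
have q1 m : \sum_i \sum_j partial i (gcoord g c j m) x * v 0 i * v 0 j = (v *m 'D_v gm x) 0 m.
  rewrite exchange_big mxE; apply: eq_bigr => j _.
  rewrite (derive_rV_sum _ dg) summxE mulr_sumr; apply: eq_bigr => i _.
  by rewrite pE mxE -mulrA mulrC -mulrA mulrC mulrA mulrAC.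
have q2 m : \sum_i \sum_j partial j (gcoord g c i m) x * v 0 i * v 0 j = (v *m 'D_v gm x) 0 m.
  rewrite -q1 exchange_big; apply: eq_bigr => j _; apply: eq_bigr => i _.
  by rewrite mulrAC.
have q3 m : \sum_i \sum_j partial m (gcoord g c i j) x * v 0 i * v 0 j =
    (v *m 'D_(delta_mx 0 m : 'rV[R]_n) gm x *m v^T) 0 0.
  rewrite [RHS]mxE exchange_big; apply: eq_bigr => j _; rewrite mxE mulr_suml.
  apply: eq_bigr => i _; rewrite pE.
  have -> : v^T j 0 = v 0 j by rewrite mxE.
  ring.
set Q := \row_m _.
have -> : w = v *m 'D_v gm x + v *m 'D_v gm x - Q.
  apply/rowP => m; transitivity ((v *m 'D_v gm x) 0 m + (v *m 'D_v gm x) 0 m - Q 0 m).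
    rewrite [w 0 m]mxE [Q 0 m]mxE -{1}q1 -q2 -q3 -big_split -sumrB/=.
    apply: eq_bigr => i _; rewrite -big_split -sumrB/=; apply: eq_bigr => j _.
    by rewrite /S; ring.
  by move: (v *m _) Q => X Y; rewrite !mxE.
move: (v *m _) Q => X Y; apply/rowP => m; by rewrite !mxE; field.
Qed.

End Noether.

(** * Curves of constant right-trivialised momentum *)

Section Trajectory.
Variables (R : realType) (n : nat) (G : lieGroupType R n) (h : pseudo_metric G).
Hypothesis h_bi : bi_invariant h.
Variable c0 : chart R n G.
Hypothesis ac0 : atlas c0.
Hypothesis c01 : cdom c0 (1%g : G).
Variable B : 'M[R]_n.
Hypothesis B_unit : B \in unitmx.
Let H0 := gmx h c0 1%g.
Implicit Types (c d : chart R n G) (p q : G) (I : set R) (gamma delta : R -> G) (m : 'rV[R]_n).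

Let Hu : H0 \in unitmx. Proof. exact: H0_unit. Qed.

Definition chart_at p : chart R n G := s2val (cid2 (atlas_cover p)).
Lemma atlas_chart_at p : atlas (chart_at p).
Proof. exact: (s2valP (cid2 (atlas_cover p))). Qed.

Lemma cdom_chart_at p : cdom (chart_at p) p.
Proof. exact: (s2valP' (cid2 (atlas_cover p))). Qed.

(* [m *m ltv p] is the left-trivialised velocity of the geodesic of [g] through [p]
   whose right-trivialised momentum is [m]. *)
Definition ltv p : 'M[R]_n := invmx H0 *m adm h c0 (chart_at p) p *m invmx B.

Lemma ltvE c p : atlas c -> cdom c p -> ltv p = invmx H0 *m adm h c0 c p *m invmx B.
Proof.
move=> ac cp; rewrite /ltv.
by rewrite (adm_change h_bi ac0 c01 (atlas_chart_at p) ac (cdom_chart_at p) cp).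
Qed.

(** This cocycle identity moves a starting point to the unit: translating back by [p] turns the
    momentum [m] into [m *m ltv p *m B]. *)
Lemma ltv_mul p q : ltv (p * q)%g = ltv p *m B *m ltv q.
Proof.
rewrite /ltv (adm_mul h_bi ac0 c01 (atlas_chart_at p) (atlas_chart_at q) (atlas_chart_at _)
  (cdom_chart_at p) (cdom_chart_at q) (cdom_chart_at _)) -/H0.
move: (adm _ _ _ p) (adm _ _ _ q) => X Y.
by rewrite -[X in _ = X *m _](mulmxA _ _ B) mulVmx// mulmx1 !mulmxA.
Qed.

(** The coadjoint transform preserves the form [invmx H0] on covectors, since [adm] is orthogonal.
    With [m] constant, this is the second conserved quantity. *)
Lemma ltv_isometry m p :
  m *m ltv p *m B *m invmx H0 *m (m *m ltv p *m B)^T = m *m invmx H0 *m m^T.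
Proof.
rewrite /ltv.
have O := adm_orthogonal h_bi ac0 c01 (atlas_chart_at p) (cdom_chart_at p).
move: (adm _ _ _ p) O; rewrite -/H0 => X O.
have -> : m *m (invmx H0 *m X *m invmx B) *m B = m *m invmx H0 *m X.
  by rewrite -!mulmxA mulVmx// mulmx1.
have Hi : (invmx H0)^T = invmx H0 by rewrite trmx_inv /H0 H0_sym.
rewrite !trmx_mul Hi.
have -> : m *m invmx H0 *m X *m invmx H0 *m (X^T *m (invmx H0 *m m^T)) =
  m *m invmx H0 *m (X *m invmx H0 *m X^T) *m invmx H0 *m m^T by rewrite !mulmxA.
by rewrite O mulmxKV.
Qed.

(** In the chart [c], the field of momentum [m] is [m *m field_mx c x]; the factor without [m] has
    regularity bounds common to all momenta. *)
Definition field_mx c (x : 'rV[R]_n) : 'M[R]_n := ltv (cbwd c x) *m ltrans c0 c (cbwd c x).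

Lemma field_mx_smooth c : atlas c -> smooth_on (cimg c) (field_mx c).
Proof.
move=> ac k; have oc : open (cimg c) by exact: open_cimg.
have SL := ltrans_smooth h_bi ac0 c01 ac k.
have SR := rtrans_smooth h_bi ac0 c01 ac k.
have Sh := gmx_smooth h ac k.
have Sc (A : 'M[R]_n) := Ck_on_cst k (cimg c) A.
have SA := Ck_on_mulmx oc (Ck_on_mulmx oc SR Sh) (Ck_on_trmx oc SL).
have := Ck_on_mulmx oc (Ck_on_mulmx oc (Ck_on_mulmx oc (Sc (invmx H0)) SA) (Sc (invmx B))) SL.
apply: (Ck_on_eq oc) => x /set_mem cx.
exact: (congr1 (mulmx^~ (ltrans c0 c (cbwd c x))) (esym (ltvE ac (cbwd_dom cx)))).
Qed.

(** Continuity is a separate clause because [cfwd c] is arbitrary outside the domain of [c], so a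
    derivative of [cfwd c \o gamma] alone says nothing about [gamma] itself. *)
Definition trajectory m I gamma := forall t, I t -> {for t, continuous gamma} /\
  forall c, atlas c -> cdom c (gamma t) ->
    is_derive t 1 (cfwd c \o gamma) (m *m ltv (gamma t) *m ltrans c0 c (gamma t)).

Lemma trajectory_chart m gamma (t : R) c d : atlas c -> atlas d ->
  cdom c (gamma t) -> cdom d (gamma t) -> {for t, continuous gamma} ->
  is_derive t 1 (cfwd c \o gamma) (m *m ltv (gamma t) *m ltrans c0 c (gamma t)) ->
  is_derive t 1 (cfwd d \o gamma) (m *m ltv (gamma t) *m ltrans c0 d (gamma t)).
Proof.
move=> ac ad ct dt cg D.
rewrite (ltrans_change h_bi ac0 c01 ac ad ct dt) mulmxA.
exact: (curve_chart (@smooth_map_id _ _ G) ac ad ct dt cg D).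
Qed.

(** A left translation leaves the left-trivialised velocity unchanged; the hypothesis equates the
    velocities prescribed by [m] at [p] and by [m'] at [a * p]. *)
Lemma trajectory_left m m' I gamma a :
  (forall p, m *m ltv p = m' *m ltv (a * p)%g) ->
  trajectory m I gamma -> trajectory m' I (fun t => a * gamma t)%g.
Proof.
move=> mm T t It; have [cg D] := T t It; split.
  have ca : {for gamma t, continuous (fun q : G => (a * q)%g)}.
    by apply: (smooth_left h_bi a).1.
  exact: (continuous_comp cg ca).
move=> d ad dt; pose c := chart_at (gamma t).
have [ac ct] := (atlas_chart_at (gamma t), cdom_chart_at (gamma t)).
rewrite -mm (ltrans_left h_bi ac0 c01 ac ad ct dt) mulmxA.
exact: (curve_chart (smooth_left h_bi a) ac ad ct dt cg (D _ ac ct)).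
Qed.

Lemma trajectory_shift m I gamma (t0 : R) : trajectory m I gamma ->
  trajectory m [set t | I (t - t0)] (fun t => gamma (t - t0)).
Proof.
move=> T t /= It; have [cg D] := T _ It.
have ds : differentiable (fun t : R => t - t0) t by apply: differentiableB.
split.
  exact: (continuous_comp (differentiable_continuous ds) cg).
move=> c ac ct; have [/derivable1_diffP D1 D2] := D c ac ct.
split; first by apply: diff_derivable; exact: (differentiable_comp ds D1).
rewrite -D2; apply: (@derive_affine _ _ _ _ (fun t : R => t - t0) (fun v => v)).
by move=> k v x; rewrite addrA.
Qed.

Lemma trajectory_near m I gamma delta (t : R) : I t ->
  trajectory m I gamma -> (\forall s \near t, gamma s = delta s) ->
  {for t, continuous delta} /\
  forall c, atlas c -> cdom c (delta t) ->
    is_derive t 1 (cfwd c \o delta) (m *m ltv (delta t) *m ltrans c0 c (delta t)).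
Proof.
move=> It T gd; have [cg D] := T t It.
have E := nbhs_singleton gd; split.
  rewrite /prop_for /continuous_at -E; apply: cvg_trans cg; exact: near_eq_cvg.
move=> c ac; rewrite -E => ct; apply: near_eq_is_derive (D c ac ct).
by move: gd; apply: filterS => s /= ->.
Qed.

End Trajectory.

Section SmoothCurve.
Variables (R : realType) (n : nat).

Lemma smooth_curve_derive (V : set R) (x : R -> 'rV[R]_n) (t : R) :
  smooth_on (V : set R^o) (x : R^o -> 'rV[R]_n) -> V t ->
  is_derive t 1 x (derive1 x t) /\ is_derive t 1 (derive1 x) (derive1n 2 x t).
Proof.
move=> S Vt.
have d1 : differentiable (x : R^o -> 'rV[R]_n) t := smooth_on_differentiable S Vt.
have d2 : differentiable ('D_(1 : R^o) (x : R^o -> 'rV[R]_n)) t.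
  exact: smooth_on_differentiable (smooth_on_derive _ S) Vt.
have E : derive1 x = 'D_(1 : R^o) (x : R^o -> 'rV[R]_n).
  by apply/funext => s; exact: derive1E.
split; first by split; [exact: diff_derivable|rewrite derive1E].
rewrite -[derive1n 2 x t]/(derive1 (derive1 x) t) derive1E.
by split => //; rewrite E; exact: diff_derivable.
Qed.

End SmoothCurve.

(** * Geodesics as curves of constant momentum *)

Section Geodesic.
Variables (R : realType) (n : nat) (G : lieGroupType R n) (h : pseudo_metric G).
Hypothesis h_bi : bi_invariant h.
Variable c0 : chart R n G.
Hypothesis ac0 : atlas c0.
Hypothesis c01 : cdom c0 (1%g : G).
Variable B : 'M[R]_n.
Hypothesis B_sym : B^T = B.
Hypothesis B_unit : B \in unitmx.
Let g := lmetric h_bi ac0 c01 B_sym B_unit.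
Let H0 := gmx h c0 1%g.
Implicit Types (c d : chart R n G) (p q : G) (I : set R) (gamma delta : R -> G) (m : 'rV[R]_n).

Let lg : left_invariant g. Proof. exact: lmetric_left_invariant. Qed.
Let Hu : H0 \in unitmx. Proof. exact: H0_unit. Qed.
Notation ltv := (ltv h c0 B).
Notation trajectory := (trajectory h c0 B).

Lemma ltrans_lmetric c p : atlas c -> cdom c p ->
  ltrans c0 c p *m gmx g c p *m (ltrans c0 c p)^T = B.
Proof. exact: lmetric_mxE. Qed.

(** Inverts the Legendre transform: the second factor sends a velocity to its right-trivialised
    momentum. *)
Lemma momentum_ltv c p : atlas c -> cdom c p ->
  (ltv p *m ltrans c0 c p) *m (gmx g c p *m (rtrans c0 c p)^T) = 1%:M.
Proof.
move=> ac cp; rewrite (ltvE h_bi ac0 c01 B ac cp) /adm.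
have E1 := mulmx1C (etrans (mulmxA _ _ _) (etrans (mulmxA _ _ _)
   (sandwich_inv B_unit (ltrans_lmetric ac cp)))).
have E2 := rtrans_metric h_bi ac0 c01 ac cp.
move: (ltrans c0 c p) (rtrans c0 c p) (gmx h c p) (gmx g c p) E1 E2 => L r hh gg E1 E2.
have -> : invmx (gmx h c0 1%g) *m (r *m hh *m L^T) *m invmx B *m L *m (gg *m r^T) =
  invmx (gmx h c0 1%g) *m (r *m hh *m (L^T *m (invmx B *m L) *m gg) *m r^T).
  by rewrite !mulmxA.
by rewrite E1 mulmx1 E2 mulVmx.
Qed.

Lemma velocity_momentum c p (v m : 'rV[R]_n) : atlas c -> cdom c p ->
  v *m gmx g c p *m (rtrans c0 c p)^T = m -> v = m *m ltv p *m ltrans c0 c p.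
Proof.
move=> ac cp <-; have := mulmx1C (momentum_ltv ac cp).
move: (ltv p) (ltrans c0 c p) (gmx g c p) (rtrans c0 c p)^T => l L gg r E.
have -> : v *m gg *m r *m l *m L = v *m (gg *m r *m (l *m L)) by rewrite !mulmxA.
by rewrite E mulmx1.
Qed.

Lemma momentum_velocity c p m : atlas c -> cdom c p ->
  m *m ltv p *m ltrans c0 c p *m gmx g c p *m (rtrans c0 c p)^T = m.
Proof.
move=> ac cp; have := momentum_ltv ac cp.
move: (ltv p) (ltrans c0 c p) (gmx g c p) (rtrans c0 c p)^T => l L gg r E.
have -> : m *m l *m L *m gg *m r = m *m (l *m L *m (gg *m r)) by rewrite !mulmxA.
by rewrite E mulmx1.
Qed.

Lemma near_chart_curve c I gamma (t : R) : open I -> I t -> cdom c (gamma t) ->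
  {for t, continuous gamma} -> \forall s \near t, (I `&` gamma @^-1` cdom c) s.
Proof.
move=> oI It ct cg; apply: filterI; first by apply: open_nbhs_nbhs.
exact: (cg _ (near_cdom ct)).
Qed.

Lemma el_geodesic c (x v a : 'rV[R]_n) : atlas c -> cimg c x ->
  (forall k, a 0 k + \sum_(i < n) \sum_(j < n) christoffel g c i j k x * v 0 i * v 0 j = 0) <->
  el g c x v a = 0.
Proof.
move=> ac cx; have E := el_christoffel g ac v a cx; rewrite /= in E.
have gu : gmx g c (cbwd c x) \in unitmx.
  by apply: gmx_nondegenerate => //; exact: cbwd_dom.
split=> [H|H].
  rewrite -E (_ : \row_k _ = 0) ?mul0mx//.
  by apply/rowP => k; rewrite mxE H mxE.
rewrite H in E => k.
have := mulmxK gu (\row_k (a 0 k +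
  \sum_(i < n) \sum_(j < n) christoffel g c i j k x * v 0 i * v 0 j)).
rewrite E mul0mx => E0.
by have := esym E0 => /rowP/(_ k); rewrite !mxE.
Qed.

Lemma derive1_near (x : R -> 'rV[R]_n) (t : R) v : is_derive t 1 x v -> derive1 x t = v.
Proof. by move=> [_ <-]; exact: derive1E. Qed.

(* [m] is the right-trivialised momentum and [e] the energy. *)
Lemma geodesic_trajectory I gamma : geodesic g I gamma ->
  exists m (e : 'M[R]_1), trajectory m I gamma /\
    forall t, I t -> m *m ltv (gamma t) *m B *m (m *m ltv (gamma t))^T = e.
Proof.
move=> [oI iI [t0 It0] cg Geo].
pose vel c (s : R) := derive1 (cfwd c \o gamma) s.
pose mom c s := vel c s *m gmx g c (gamma s) *m (rtrans c0 c (gamma s))^T.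
pose en c s := vel c s *m gmx g c (gamma s) *m (vel c s)^T.
have D c s : atlas c -> I s -> cdom c (gamma s) -> is_derive s 1 (cfwd c \o gamma) (vel c s).
  move=> ac Is cs; have [S _] := Geo c ac.
  by have [] := smooth_curve_derive S (conj Is cs).
have velE c d s : atlas c -> atlas d -> I s -> cdom c (gamma s) -> cdom d (gamma s) ->
    vel d s = vel c s *m jac id c d (gamma s).
  move=> ac ad Is cs ds.
  have H := curve_chart (@smooth_map_id _ _ G) ac ad cs ds (cg s Is) (D c s ac Is cs).
  exact: derive1_near H.
have momE c d s : atlas c -> atlas d -> I s -> cdom c (gamma s) -> cdom d (gamma s) ->
    mom c s = mom d s.
  move=> ac ad Is cs ds; rewrite /mom (velE _ _ _ ac ad Is cs ds).
  rewrite (gmx_change_jac g ac ad cs ds) (rtrans_change h_bi ac0 c01 ac ad cs ds) trmx_mul.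
  by move: (vel c s) (jac _ _ _ _) (gmx _ _ _) (rtrans _ _ _) => a b e f; rewrite !mulmxA.
have enE c d s : atlas c -> atlas d -> I s -> cdom c (gamma s) -> cdom d (gamma s) ->
    en c s = en d s.
  move=> ac ad Is cs ds; rewrite /en (velE _ _ _ ac ad Is cs ds).
  rewrite (gmx_change_jac g ac ad cs ds) trmx_mul.
  by move: (vel c s) (jac _ _ _ _) (gmx _ _ _) => a b e; rewrite !mulmxA.
have key c s : atlas c -> I s -> cdom c (gamma s) ->
    is_derive s 1 (mom c) 0 /\ is_derive s 1 (en c) 0.
  move=> ac Is cs; have [S E] := Geo c ac.
  have [D1 D2] := smooth_curve_derive S (conj Is cs).
  have cx : cimg c ((cfwd c \o gamma) s) by exact: cfwd_img.
  have EL := (el_geodesic _ _ ac cx).1 (E s Is cs).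
  have N1 := noether h_bi ac0 c01 lg ac cx D1 D2.
  have N2 := energy_derive g ac cx D1 D2.
  rewrite EL !mul0mx in N1 N2; rewrite scaler0 in N2.
  have N := near_chart_curve oI Is cs (cg s Is).
  split; [apply: near_eq_is_derive N1|apply: near_eq_is_derive N2];
    by move: N; apply: filterS => u [_ cu]; rewrite /mom /en /vel /= cfwdK.
(* Read in a chart that depends on [s], momentum and energy become functions on all of [I]. By
   [momE] and [enE] they agree near each time with their values in one fixed chart, and so are
   differentiable. *)
pose Mom s := mom (chart_at (gamma s)) s.
pose En s := en (chart_at (gamma s)) s.
have near_at s : I s -> \forall u \near s, I u /\ cdom (chart_at (gamma s)) (gamma u).
  by move=> Is; exact: (near_chart_curve oI Is (cdom_chart_at _) (cg s Is)).
have dMom s : I s -> is_derive s 1 Mom 0.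
  move=> Is; have [K _] := key _ s (atlas_chart_at _) Is (cdom_chart_at _).
  apply: near_eq_is_derive K; move: (near_at s Is); apply: filterS => u [Iu cu].
  exact: momE (atlas_chart_at _) (atlas_chart_at _) Iu cu (cdom_chart_at _).
have dEn s : I s -> is_derive s 1 En 0.
  move=> Is; have [_ K] := key _ s (atlas_chart_at _) Is (cdom_chart_at _).
  apply: near_eq_is_derive K; move: (near_at s Is); apply: filterS => u [Iu cu].
  exact: enE (atlas_chart_at _) (atlas_chart_at _) Iu cu (cdom_chart_at _).
have V c s : atlas c -> I s -> cdom c (gamma s) ->
    vel c s = Mom t0 *m ltv (gamma s) *m ltrans c0 c (gamma s).
  move=> ac Is cs; apply: (velocity_momentum ac cs).
  rewrite (derive0_constant iI dMom It0 Is).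
  exact: momE (atlas_chart_at _) Is cs (cdom_chart_at _).
exists (Mom t0), (En t0); split=> [s Is|s Is].
  by split=> [|c ac cs]; [exact: cg|rewrite -(V c s ac Is cs); exact: D].
rewrite (derive0_constant iI dEn It0 Is) /En /en.
rewrite (V _ _ (atlas_chart_at _) Is (cdom_chart_at _)).
move: (ltrans_lmetric (atlas_chart_at (gamma s)) (cdom_chart_at (gamma s))).
move: (ltrans c0 _ _) (gmx g _ _) (Mom t0 *m ltv (gamma s)) => L gg w <-.
by rewrite !trmx_mul !mulmxA.
Qed.

(** The momentum is constant, so [noether] makes the product of [el] with the invertible matrix of
    the right-invariant frame vanish. *)
Lemma trajectory_geodesic m I gamma : open I -> is_interval I -> I !=set0 ->
  trajectory m I gamma -> geodesic g I gamma.
Proof.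
move=> oI iI I0 T; have cg t : I t -> {for t, continuous gamma} by move=> /T[].
split=> // c ac x.
have oV : open (I `&` gamma @^-1` cdom c).
  rewrite openE => t [It ct].
  exact: near_chart_curve oI It ct (cg t It).
have oW : open (cimg c) by exact: open_cimg.
have sf : smooth_on (cimg c) (fun y => m *m field_mx h c0 B c y).
  by move=> k; exact: Ck_on_mulmx oW (Ck_on_cst k _ m) (field_mx_smooth h_bi ac0 c01 B ac k).
have VW t : (I `&` gamma @^-1` cdom c) t -> cimg c (x t) by move=> [_ ct]; exact: cfwd_img.
have Dx t : (I `&` gamma @^-1` cdom c) t -> is_derive t 1 x (m *m field_mx h c0 B c (x t)).
  move=> [It ct]; rewrite /field_mx /x /= cfwdK// mulmxA.
  by have [_ /(_ c ac ct)] := T t It.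
have S := ode_smooth oW oV sf VW Dx.
split=> // t It ct.
have Vt : (I `&` gamma @^-1` cdom c) t by [].
have cx := VW t Vt.
have [D1 D2] := smooth_curve_derive S Vt.
apply/(el_geodesic _ _ ac cx).
have N := noether h_bi ac0 c01 lg ac cx D1 D2.
have N0 : is_derive t 1 (fun _ : R => m) (0 : 'rV[R]_n) by exact: is_derive_cst.
have NE : \forall s \near t, derive1 x s *m gmx g c (cbwd c (x s)) *m
    (rtrans c0 c (cbwd c (x s)))^T = m.
  have := near_chart_curve oI It ct (cg t It); apply: filterS => s Vs.
  rewrite (derive1_near (Dx s Vs)) /field_mx /x /= cfwdK; last exact: Vs.2.
  by rewrite mulmxA; exact: (momentum_velocity m ac Vs.2).
have [_ E1] := near_eq_is_derive NE N.
have [_ E0] := N0.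
have E := etrans (esym E1) E0.
have ru : (rtrans c0 c (cbwd c (x t)))^T \in unitmx.
  by rewrite unitmx_tr; apply: (rtrans_unit h_bi ac0 c01 ac); exact: cbwd_dom.
by rewrite -[LHS](mulmxK ru) E mul0mx.
Qed.

End Geodesic.

(** * Completeness *)

Section Completeness.
Variables (R : realType) (n : nat) (G : lieGroupType R n) (h : pseudo_metric G).
Hypothesis h_bi : bi_invariant h.
Variable c0 : chart R n G.
Hypothesis ac0 : atlas c0.
Hypothesis c01 : cdom c0 (1%g : G).
Variable B : 'M[R]_n.
Hypothesis B_sym : B^T = B.
Hypothesis B_unit : B \in unitmx.
Let g := lmetric h_bi ac0 c01 B_sym B_unit.
Let H0 := gmx h c0 1%g.
Implicit Types (c d : chart R n G) (p q : G) (I : set R) (gamma delta : R -> G) (m : 'rV[R]_n).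
Notation ltv := (ltv h c0 B).
Notation trajectory := (trajectory h c0 B).

(** As the field is linear in [m], a bound on [m] scales the size and Lipschitz constants of
    [field_mx] at the unit uniformly, and [local_ode] gives one lifetime for all such [m]. *)
Lemma trajectory_exists (C : R) : 0 <= C -> exists2 e : R, 0 < e &
  forall m, `|m| <= C ->
  exists2 delta, delta 0 = 1%g & trajectory m [set t | -e < t < e] delta.
Proof.
move=> C0; pose x0 := cfwd c0 1%g.
have oW : open (cimg c0) by exact: open_cimg.
have cx0 : cimg c0 x0 by exact: cfwd_img.
pose S := field_mx h c0 B c0.
have [rho [K [r0 K0 HU HK]]] := C1_lipschitz oW cx0
  (field_mx_smooth h_bi ac0 c01 B ac0 1%N : Ck_on 1 _ S).
have nC0 : 0 <= n%:R * C by rewrite mulr_ge0.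
have [e e0 He] := @local_ode R n (n%:R * C * K) (n%:R * C * `|S x0|) rho
  (mulr_ge0 nC0 K0) (mulr_ge0 nC0 (normr_ge0 _)) r0.
exists e => // m mC.
have mN (A : 'M[R]_n) : `|m *m A| <= n%:R * C * `|A|.
  by rewrite (le_trans (mulmx_norm _ _))// ler_wpM2r// ler_wpM2l.
have [|x x00 Hx] := He (fun y => m *m S y) x0 (mN _).
  move=> y z hy hz; rewrite -mulmxBr (le_trans (mN _))// -[leRHS]mulrA ler_wpM2l//.
  exact: HK.
exists (cbwd c0 \o x) => [|t te]; first by rewrite /= x00 cfwdK.
have [h1 h2] := Hx t te.
have cx : cimg c0 (x t) by exact: HU.
have cd : {for t, continuous (cbwd c0 \o x)}.
  exact: (continuous_comp (is_derive_continuous h2) (cbwd_continuous cx)).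
split=> // c ac ct.
apply: (trajectory_chart h_bi ac0 c01 ac0 ac (cbwd_dom cx) ct cd).
rewrite -mulmxA; apply: near_eq_is_derive h2.
have oI : open [set s : R | -e < s < e].
  by rewrite (_ : [set s | _] = `]-e, e[%classic); [exact: interval_open|rewrite set_itvE].
have := open_nbhs_nbhs (conj oI te : open_nbhs (t : R) [set s : R | -e < s < e]).
apply: filterS => s se /=; rewrite cbwdK//; apply: HU.
by have [] := Hx s se.
Qed.

Lemma trajectory_near_unique m I gamma delta (t : R) : open I -> I t ->
  trajectory m I gamma -> trajectory m I delta -> gamma t = delta t ->
  \forall s \near t, gamma s = delta s.
Proof.
move=> oI It Tg Td E; pose c := chart_at (gamma t).
have ac : atlas c by exact: atlas_chart_at.
have ct : cdom c (gamma t) by exact: cdom_chart_at.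
have dt : cdom c (delta t) by rewrite -E.
have Ng := near_chart_curve oI It ct (Tg t It).1.
have Nd := near_chart_curve oI It dt (Td t It).1.
have oW : open (cimg c) by exact: open_cimg.
have [rho [K [r0 K0 HU HK]]] := C1_lipschitz oW (cfwd_img ct)
  (field_mx_smooth h_bi ac0 c01 B ac 1%N).
have D eta : trajectory m I eta -> (\forall s \near t, (I `&` eta @^-1` cdom c) s) ->
    \forall s \near t, is_derive (s : R) 1 (cfwd c \o eta)
      (m *m field_mx h c0 B c ((cfwd c \o eta) s)).
  move=> T; apply: filterS => s [Is cs]; rewrite /field_mx /= cfwdK// mulmxA.
  by have [_ /(_ c ac cs)] := T s Is.
have E0 : (cfwd c \o gamma) t = (cfwd c \o delta) t by rewrite /= E.
have nm0 : 0 <= n%:R * `|m| * K by rewrite !mulr_ge0.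
have LU := @local_uniqueness R n (fun y => m *m field_mx h c0 B c y) _ _ t
  (n%:R * `|m| * K) rho r0 nm0 _ (D _ Tg Ng) (D _ Td Nd) E0.
have {}LU : \forall s \near t, (cfwd c \o gamma) s = (cfwd c \o delta) s.
  apply: LU => u v hu hv; rewrite -mulmxBr (le_trans (mulmx_norm _ _))//.
  rewrite -[leRHS]mulrA ler_wpM2l//.
  exact: HK.
move: Ng Nd LU; apply: filterS3 => s [_ cg] [_ cd] /= Es.
by rewrite -(cfwdK cg) Es cfwdK.
Qed.

(** The agreement set is open in [I] by local uniqueness, closed in [I] because [G] is Hausdorff,
    and contains [t0]; intervals are connected. *)
Lemma trajectory_unique m I gamma delta (t0 t : R) : open I -> is_interval I ->
  trajectory m I gamma -> trajectory m I delta -> I t0 -> I t ->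
  gamma t0 = delta t0 -> gamma t = delta t.
Proof.
move=> oI iI Tg Td It0 It E0.
pose A := [set s | I s /\ gamma s = delta s].
suff AI : A = I by move: It; rewrite -AI => -[].
have nearA s : A s -> nbhs s A.
  move=> [Is Es]; have N := trajectory_near_unique oI Is Tg Td Es.
  apply: filterS2 (open_nbhs_nbhs (conj oI Is : open_nbhs (s : R) I)) N.
  by move=> u Iu Eu; split.
have /connected_intervalP cI := iI.
apply: cI; first by exists t0.
  exists A.
    by rewrite openE => s /nearA.
  by apply/seteqP; split=> s // [] .
exists (closure A); first exact: closed_closure.
apply/seteqP; split=> [s As|s [Is cs]]; first by split; [exact: As.1|exact: subset_closure].
split=> //; apply: manifold_hausdorff => U V Ug Vd.
have N : nbhs s (gamma @^-1` U `&` delta @^-1` V).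
  by apply: filterI; [exact: ((Tg s Is).1 _ Ug)|exact: ((Td s Is).1 _ Vd)].
have [u [[_ Eu] [/= Uu Vu]]] := cs _ N.
by exists (gamma u); split => //; rewrite Eu.
Qed.

Lemma trajectory_glue m I K gamma delta : open I -> open K ->
  trajectory m I gamma -> trajectory m K delta ->
  (forall t, I t -> K t -> gamma t = delta t) ->
  exists2 eta, trajectory m (I `|` K) eta & forall t, I t -> eta t = gamma t.
Proof.
move=> oI oK Tg Td E.
pose eta t := if `[< I t >] then gamma t else delta t.
have eg t : I t -> eta t = gamma t by move=> It; rewrite /eta asboolT.
have ed t : K t -> eta t = delta t.
  by move=> Kt; rewrite /eta; case: asboolP => // It; exact: E.
exists eta => // t [It|Kt].
  apply: (trajectory_near It Tg).
  have := open_nbhs_nbhs (conj oI It : open_nbhs (t : R) I).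
  by apply: filterS => s /eg.
apply: (trajectory_near Kt Td).
have := open_nbhs_nbhs (conj oK Kt : open_nbhs (t : R) K).
by apply: filterS => s /ed.
Qed.

Hypothesis definite : forall E : R, exists C : R, forall v : 'rV[R]_n,
  (v *m (B *m invmx H0 *m B + B) *m v^T) 0 0 = E -> `|v *m B| <= C.

Lemma interval_translates_setT I (e : R) : is_interval I -> I !=set0 -> 0 < e ->
  (forall t, I t -> I (t - e) /\ I (t + e)) -> I = setT.
Proof.
move=> iI [t0 It0] e0 H; apply/seteqP; split => // t _.
have A k : I (t0 - e *+ k) /\ I (t0 + e *+ k).
  elim: k => [|k [IH1 IH2]]; first by rewrite mulr0n subr0 addr0.
  by rewrite mulrSr opprD !addrA; split; [exact: (H _ IH1).1|exact: (H _ IH2).2].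
pose k := Num.bound (`|t - t0| / e).
have hk : `|t - t0| <= e *+ k.
  have := archi_boundP (divr_ge0 (normr_ge0 (t - t0)) (ltW e0)).
  by rewrite ltr_pdivrMr// mulr_natl => /ltW.
have [A1 A2] := A k.
apply: (iI _ _ A1 A2); move: hk; rewrite ler_norml; lra.
Qed.

Lemma lmetric_complete : geodesically_complete g.
Proof.
move=> I gamma [Geo Max].
have [oI iI [t1 It1] cg _] := Geo.
have [m [e [T En]]] := geodesic_trajectory Geo.
have [C HC] := definite ((m *m invmx H0 *m m^T + e) 0 0).
(* The energy [e] plus the invariant form of [m] is the value of the definite form at the
   left-trivialised velocity, and it is the same at all times. *)
have B1 t : I t -> `|m *m ltv (gamma t) *m B| <= C.
  move=> It; apply: HC; congr (fun_of_matrix _ 0 0).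
  rewrite -(En t It) -(ltv_isometry h_bi ac0 c01 B_unit m (gamma t)).
  move: (m *m ltv _) => w.
  by rewrite mulmxDr mulmxDl trmx_mul B_sym !mulmxA.
have C0 : 0 <= C by apply: le_trans (B1 t1 It1).
have [ep ep0 Hex] := trajectory_exists C0.
(* Half the lifetime, so that the endpoints of the step lie inside the open interval [K]. *)
apply: (@interval_translates_setT I (ep / 2) iI); [by exists t1|by rewrite divr_gt0|].
move=> t0 It0.
(* Restart at the unit with the momentum seen from [gamma t0], which [B1] bounds independently of
   [t0]; translating by [gamma t0] then restores [m]. *)
have [delta0 d01 Td0] := Hex _ (B1 t0 It0).
pose K := [set t : R | t0 - ep < t < t0 + ep].
pose delta t := (gamma t0 * delta0 (t - t0))%g.
have Td : trajectory m K delta.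
  have T1 := @trajectory_shift _ _ _ _ _ _ _ _ _ t0 Td0.
  have mm p : m *m ltv (gamma t0) *m B *m ltv p = m *m ltv (gamma t0 * p)%g.
    by rewrite (ltv_mul h_bi ac0 c01 B_unit) !mulmxA.
  have T2 := trajectory_left h_bi ac0 c01 mm T1.
  move=> t Kt; apply: T2 => /=; move: Kt; rewrite /K /=; lra.
have oK : open K.
  by rewrite (_ : K = `]t0 - ep, t0 + ep[%classic); [exact: interval_open|rewrite set_itvE].
have iK : is_interval K by exact: is_interval_oo.
have Kt0 : K t0 by rewrite /K /=; lra.
have iIK : is_interval (I `&` K).
  move=> a b [Ia Ka] [Ib Kb] c abc; split; first exact: (iI a b Ia Ib c abc).
  exact: (iK a b Ka Kb c abc).
have agree t : I t -> K t -> gamma t = delta t.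
  move=> It Kt.
  have S J J' eta : J `<=` J' -> trajectory m J' eta -> trajectory m J eta.
    by move=> JJ TT s /JJ; exact: TT.
  apply: (@trajectory_unique m (I `&` K) gamma delta t0 t (openI oI oK) iIK) => //.
  - by apply: S T => s [].
  - by apply: S Td => s [].
  - by rewrite /delta subrr d01 mulg1.
have [eta Teta Eeta] := trajectory_glue oI oK T Td agree.
have oU : open (I `|` K) by exact: openU.
have iU : is_interval (I `|` K).
  move=> a b Ha Hb c /andP[ac cb].
  have [ct|tc] := leP c t0.
    case: Ha => [Ia|Ka]; [left; apply: (iI a t0)|right; apply: (iK a t0)] => //; exact/andP.
  case: Hb => [Ib|Kb]; [left; apply: (iI t0 b)|right; apply: (iK t0 b)] => //;
    by rewrite cb ltW.
have GU := @trajectory_geodesic _ _ _ _ h_bi _ ac0 c01 _ B_sym B_unit m (I `|` K) eta oU iU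
  (ex_intro _ t0 (or_introl It0)) Teta.
(* Maximality forces the glued geodesic to have domain [I], so [K] was already contained in [I]. *)
have EI := Max _ _ GU (@subsetUl _ _ _) Eeta.
have KI s : K s -> I s by move=> Ks; rewrite -EI; right.
by split; apply: KI; rewrite /K /=; lra.
Qed.

End Completeness.

(** * Symmetric bilinear forms *)

Section Sylvester.
Variable R : realType.

(** Polarisation: if [A i j] is nonzero and both diagonal entries vanish, the sum of the two basis
    vectors has square [2 * A i j]. *)
Lemma symmetric_nonisotropic n (A : 'M[R]_n) : A^T = A -> A != 0 ->
  exists v : 'rV[R]_n, (v *m A *m v^T) 0 0 != 0.
Proof.
move=> As A0.
have entry (u v : 'rV[R]_n) i j :
    u = delta_mx 0 i -> v = delta_mx 0 j -> (u *m A *m v^T) 0 0 = A i j.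
  by move=> -> ->; rewrite -rowE trmx_delta -colE !mxE.
have [i [j Aij]] : exists i j, A i j != 0.
  have [/existsP[i /existsP[j ?]]|/existsPn H] := boolP [exists i, exists j, A i j != 0].
    by exists i, j.
  case/eqP: A0; apply/matrixP => i j; have /existsPn/(_ j) := H i.
  by rewrite negbK mxE => /eqP.
have [Aii|Aii] := eqVneq (A i i) 0; last by exists (delta_mx 0 i); rewrite (entry _ _ i i).
have [Ajj|Ajj] := eqVneq (A j j) 0; last by exists (delta_mx 0 j); rewrite (entry _ _ j j).
exists (delta_mx 0 i + delta_mx 0 j).
have mxD (X Y : 'M[R]_1) : (X + Y) 0 0 = X 0 0 + Y 0 0 by rewrite mxE.
rewrite linearD/= mulmxDr !mulmxDl !mxD.
rewrite (entry _ _ i i)// (entry _ _ j i)// (entry _ _ i j)// (entry _ _ j j)// Aii Ajj.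
have -> : A j i = A i j by rewrite -[in LHS]As mxE.
by rewrite add0r addr0 -mulr2n mulrn_eq0.
Qed.

(** The matrix with all rows equal to [v] already has the right first row; being injective on the
    line of the first basis vector, it can be corrected elsewhere to an invertible matrix. *)
Lemma unitmx_first_row n (v : 'rV[R]_n.+1) : v != 0 ->
  exists2 Q : 'M[R]_n.+1, Q \in unitmx & delta_mx 0 0 *m Q = v.
Proof.
move=> v0; pose f : 'M[R]_n.+1 := \matrix_(k, l) v 0 l.
have Ef : delta_mx 0 0 *m f = v by rewrite -rowE; apply/rowP => l; rewrite !mxE.
have rk : \rank ((delta_mx 0 0 : 'rV[R]_n.+1) *m f) = \rank (delta_mx 0 0 : 'rV[R]_n.+1).
  by rewrite Ef mxrank_delta rank_rV v0.
by have [Q Qu EQ] := complete_unitmx rk; exists Q => //; rewrite -EQ.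
Qed.

(** One step of symmetric Gauss elimination; [C] is the Schur complement of the pivot. *)
Lemma symmetric_clear n (A : 'M[R]_(1 + n)) : A^T = A -> A 0 0 != 0 ->
  exists2 L : 'M[R]_(1 + n), L \in unitmx &
  exists2 C : 'M[R]_n, C^T = C & L *m A *m L^T = block_mx (A 0 0)%:M 0 0 C.
Proof.
move=> As; set a := A 0 0 => a0.
pose b : 'rV[R]_n := ursubmx A; pose C : 'M[R]_n := drsubmx A.
have AE : A = block_mx a%:M b b^T C.
  rewrite -[LHS](@submxK _ 1 n 1 n); congr block_mx.
    by apply/matrixP => i j; rewrite !ord1 !mxE /a mulr1n; congr (A _ _); apply/val_inj.
  by apply/matrixP => i j; rewrite /b !mxE -[in LHS]As mxE.
pose L : 'M[R]_(1 + n) := block_mx 1%:M 0 (- a^-1 *: b^T) 1%:M.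
exists L; first by rewrite unitmxE det_lblock !det1 mulr1 unitr1.
have Cs : C^T = C by apply/matrixP => i j; rewrite /C !mxE -[in RHS]As mxE.
exists (C - a^-1 *: (b^T *m b)).
  by rewrite linearB linearZ/= trmx_mul trmxK Cs.
rewrite [in LHS]AE /L tr_block_mx !mulmx_block.
rewrite !mul1mx !mul0mx !trmx1 !trmx0 !mulmx0 !mulmx1 !addr0.
have E1 : - a^-1 *: b^T *m a%:M + b^T = 0.
  by rewrite mul_mx_scalar scalerA mulrN divff// scaleN1r addNr.
have E2 : a%:M *m (- a^-1 *: b^T)^T + b = 0.
  by rewrite mul_scalar_mx linearZ/= trmxK scalerA mulrN divff// scaleN1r addNr.
rewrite E1 E2 mul0mx add0r; congr block_mx.
by rewrite -scalemxAl scaleNr addrC.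
Qed.

Lemma symmetric_diagonalize n (A : 'M[R]_n) : A^T = A ->
  exists2 P : 'M[R]_n, P \in unitmx & exists d : 'rV[R]_n, P *m A *m P^T = diag_mx d.
Proof.
elim: n A => [|n IH] A As.
  by exists 1%:M; [exact: unitmx1|exists 0; apply/matrixP => -[]].
have [->|A0] := eqVneq A 0.
  exists 1%:M; [exact: unitmx1|exists 0].
  by rewrite mulmx0 mul0mx; apply/matrixP => i j; rewrite !mxE mul0rn.
have [v vAv] := symmetric_nonisotropic As A0.
have v0 : v != 0 by apply: contra_neq vAv => ->; rewrite mul0mx mul0mx mxE.
have [Q Qu EQ] := unitmx_first_row v0.
pose A1 : 'M[R]_(1 + n) := Q *m A *m Q^T.
have A1s : A1^T = A1 by rewrite /A1 !trmx_mul trmxK As mulmxA.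
pose a := A1 0 0.
have a0 : a != 0.
  suff -> : a = (v *m A *m v^T) 0 0 by [].
  rewrite -EQ trmx_mul trmx_delta.
  have E (u : 'rV[R]_n.+1) (w : 'cV[R]_n.+1) :
    u *m Q *m A *m (Q^T *m w) = u *m (Q *m A *m Q^T) *m w by rewrite !mulmxA.
  by rewrite E -rowE -colE [RHS]mxE [RHS]mxE.
have [L Lu [C' C's LA]] := symmetric_clear A1s a0.
have [P1 P1u [d1 E1]] := IH C' C's.
pose P2 : 'M[R]_(1 + n) := block_mx 1%:M 0 0 P1.
have P2u : P2 \in unitmx by rewrite unitmxE det_lblock det1 mul1r -unitmxE.
exists (P2 *m L *m Q); first by rewrite !unitmx_mul P2u Lu Qu.
exists (row_mx a%:M d1).
have -> : P2 *m L *m Q *m A *m (P2 *m L *m Q)^T = P2 *m (L *m A1 *m L^T) *m P2^T.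
  by rewrite /A1 !trmx_mul !mulmxA.
rewrite LA /P2 tr_block_mx !mulmx_block !trmx1 !trmx0.
rewrite !mul1mx !mul0mx !mulmx0 !mulmx1 !addr0 !add0r E1.
rewrite (diag_mx_row (a%:M : 'rV[R]_1) d1).
have -> : diag_mx (a%:M : 'rV[R]_1) = a%:M.
  by move: a {a0 LA} => a; apply/matrixP => i j; rewrite !ord1 !mxE.
by rewrite mul0mx.
Qed.

Lemma diag_normalize n (d : 'rV[R]_n) : (forall i, d 0 i != 0) ->
  exists2 P : 'M[R]_n, P \in unitmx &
    P *m diag_mx d *m P^T = diag_mx (\row_i Num.sg (d 0 i)).
Proof.
move=> d0; pose e : 'rV[R]_n := \row_i (Num.sqrt `|d 0 i|)^-1.
have e0 i : Num.sqrt `|d 0 i| != 0 by rewrite sqrtr_eq0 -ltNge normr_gt0.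
exists (diag_mx e).
  rewrite unitmxE det_diag unitfE; apply/prodf_neq0 => i _.
  by rewrite mxE invr_eq0.
rewrite tr_diag_mx !mulmx_diag; congr diag_mx; apply/rowP => i; rewrite !mxE.
rewrite [X in X * _]mulrC -mulrA -expr2 exprVn sqr_sqrtr//.
by rewrite {1}[d 0 i]numEsg mulfK// normr_eq0.
Qed.

(** Two boolean tuples with the same number of true entries are permutations of each other. *)
Lemma perm_of_card n (a : pred 'I_n) (k : nat) : #|a| = k ->
  exists s : {perm 'I_n}, forall i, a (s i) = (i < k)%N.
Proof.
move=> ak.
have kn : (k <= n)%N by rewrite -ak -[n in (_ <= n)%N]card_ord max_card.
pose s1 := [tuple a i | i < n].
pose s2 := [tuple (i < k)%N | i < n].
have c1 : count_mem true s1 = k.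
  rewrite -ak cardE /= count_map -size_filter.
  by rewrite enumT; congr size; apply: eq_filter => i /=; rewrite eqb_id.
have c2 : count_mem true s2 = k.
  rewrite /= count_map (eq_count (a2 := preim val (fun i => i < k)%N)); last first.
    by move=> i /=; rewrite eqb_id.
  rewrite -count_map val_enum_ord -size_filter.
  by have := @filter_iota_ltn 0 n k kn; rewrite add0n => ->; rewrite size_iota.
have /tuple_permP [p Ep] : perm_eq s2 s1.
  apply/allP => b _; apply/eqP.
  case: b; first exact: etrans c2 (esym c1).
  have H (s : n.-tuple bool) : count_mem false s = (n - count_mem true s)%N.
    rewrite -[n in (n - _)%N](size_tuple s) -(count_predC (pred1 true) s) addKn.
    by apply: eq_count => -[].
  apply: (etrans (H s2)); apply: etrans (esym (H s1)); congr (n - _)%N.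
  exact: etrans c2 (esym c1).
have {}Ep : s2 = [tuple tnth s1 (p i) | i < n] by exact: val_inj.
exists p => i; have := congr1 (fun t : n.-tuple bool => tnth t i) Ep.
by rewrite !tnth_mktuple.
Qed.

Lemma perm_diag n (s : {perm 'I_n}) (d : 'rV[R]_n) :
  perm_mx s *m diag_mx d *m (perm_mx s)^T = diag_mx (\row_i d 0 (s i)).
Proof.
rewrite tr_perm_mx -row_permE -col_permE.
apply/matrixP => i j; rewrite !mxE (inj_eq perm_inj).
by [].
Qed.

(** The negative entries are put first, unlike in [mx_signature], so that in [definite_form] they
    face the positive entries of [lam]. *)
Lemma symmetric_signature n (A : 'M[R]_n) : A^T = A -> A \in unitmx ->
  exists q : nat, (q <= n)%N /\ exists2 P : 'M[R]_n, P \in unitmx &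
    P *m A *m P^T = diag_mx (\row_(i < n) (if (i < q)%N then -1 else 1)).
Proof.
move=> As Au; have [P Pu [d E]] := symmetric_diagonalize As.
have d0 i : d 0 i != 0.
  have : diag_mx d \in unitmx by rewrite -E !unitmx_mul Pu Au unitmx_tr Pu.
  by rewrite unitmxE det_diag unitfE => /prodf_neq0 /(_ i isT).
have [S Su ES] := diag_normalize d0.
pose a := [pred i | d 0 i < 0].
have [s Hs] := @perm_of_card n a _ erefl.
exists #|a|; split; first by rewrite -[n in (_ <= n)%N]card_ord max_card.
exists (perm_mx s *m (S *m P)); first by rewrite !unitmx_mul unitmx_perm Su Pu.
have -> : perm_mx s *m (S *m P) *m A *m (perm_mx s *m (S *m P))^T =
  perm_mx s *m (S *m (P *m A *m P^T) *m S^T) *m (perm_mx s)^T.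
  by rewrite !trmx_mul !mulmxA.
rewrite E ES perm_diag; congr diag_mx; apply/rowP => i; rewrite !mxE -Hs /=.
have [h|h] := ltP (d 0 (s i)) 0; first exact: ltr0_sg.
by rewrite gtr0_sg// lt_neqAle eq_sym d0 h.
Qed.

(** The bound [4^-1] is the least absolute value of the entries produced in [definite_form]. The
    linear bound on the norm avoids a square root: [x ^+ 2 <= 4 * y] implies [x <= 4 * y + 1]. *)
Lemma quadratic_diag_bound n (w e : 'rV[R]_n) (sg E : R) :
  sg = 1 \/ sg = -1 -> (forall i, 4^-1 <= sg * e 0 i) ->
  (w *m diag_mx e *m w^T) 0 0 = E -> `|w| <= 4 * `|E| + 1.
Proof.
move=> sgE He EE.
have S : sg * E = \sum_i sg * e 0 i * w 0 i ^+ 2.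
  rewrite -EE mul_mx_diag mxE mulr_sumr; apply: eq_bigr => i _; rewrite !mxE; ring.
have H0 i : 0 <= sg * e 0 i * w 0 i ^+ 2.
  by rewrite mulr_ge0 ?sqr_ge0// (le_trans _ (He i))// invr_ge0.
have sE : sg * E <= `|E|.
  case: sgE => ->; rewrite ?mul1r ?mulN1r; first exact: ler_norm.
  by rewrite -normrN; exact: ler_norm.
apply/mx_norm_leP => [|i j]; first by rewrite addr_ge0 ?mulr_ge0.
rewrite ord1.
have h1 : 4^-1 * w 0 j ^+ 2 <= `|E|.
  apply: le_trans sE; rewrite S (bigD1 j)//=.
  by rewrite -[leLHS]addr0 lerD ?sumr_ge0// ler_wpM2r ?sqr_ge0.
have h2 : `|w 0 j| ^+ 2 = w 0 j ^+ 2 by rewrite real_normK// num_real.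
have h3 : 0 <= `|w 0 j| by [].
rewrite -h2 in h1; move: h1 h3; move: `|w 0 j| `|E| => x y; nra.
Qed.

(** In a basis where [H] is diagonal with entries [d], the form has entries [lam * (lam * d + 1)].
    For a positive one, [d = -1] requires [0 < lam < 1], while [d = 1] allows [lam > 0] or
    [lam < -1]: the [q] negative entries of [d] must fall among the [r] positive ones of [lam]. The
    negative case is the mirror image and needs [r <= q]. *)
Lemma definite_form n (H : 'M[R]_n) (r s : nat) : H^T = H -> H \in unitmx -> (r + s)%N = n ->
  exists B : 'M[R]_n, [/\ B^T = B, B \in unitmx, mx_signature B r s &
  forall E : R, exists C : R, forall v : 'rV[R]_n,
  (v *m (B *m invmx H *m B + B) *m v^T) 0 0 = E -> `|v *m B| <= C].
Proof.
move=> Hs Hu rs; have [q [qn [P Pu E]]] := symmetric_signature Hs Hu.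
pose d : 'rV[R]_n := \row_(i < n) (if (i < q)%N then -1 else 1).
pose sg : R := if (q <= r)%N then 1 else -1.
(* [lam * (lam * d + 1)] has the constant sign [sg]. *)
pose lam : 'rV[R]_n := \row_(i < n) (if (q <= r)%N then (if (i < r)%N then 2^-1 else -2)
  else (if (i < r)%N then 2 else - 2^-1)).
pose B := invmx P *m diag_mx lam *m (invmx P)^T.
have PB : P *m B *m P^T = diag_mx lam.
  by rewrite /B !mulmxA mulmxV// mul1mx -mulmxA -trmx_mul mulmxV// trmx1 mulmx1.
have lam0 i : lam 0 i != 0.
  by rewrite mxE; case: ifP => _; case: ifP => _; rewrite ?oppr_eq0 ?invr_eq0 pnatr_eq0.
have Bs : B^T = B by rewrite /B !trmx_mul trmxK tr_diag_mx mulmxA.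
have Lu : diag_mx lam \in unitmx.
  by rewrite unitmxE det_diag unitfE; apply/prodf_neq0 => i _.
have Bu : B \in unitmx by rewrite /B !unitmx_mul unitmx_tr !unitmx_inv Pu Lu.
exists B; split => //.
  split=> //; have [S Su ES] := diag_normalize lam0.
  exists (S *m P); first by rewrite unitmx_mul Su Pu.
  have -> : S *m P *m B *m (S *m P)^T = S *m (P *m B *m P^T) *m S^T.
    by rewrite trmx_mul !mulmxA.
  rewrite PB ES; congr diag_mx; apply/rowP => i; rewrite !mxE.
  by case: ifP => _; case: ifP => _; rewrite ?sgrN ?gtr0_sg// ?invr_gt0.
have Hi : P^T *m diag_mx d *m P = invmx H.
  have dd : diag_mx d *m diag_mx d = 1%:M.
    rewrite mulmx_diag -diag_const_mx; congr diag_mx; apply/rowP => i; rewrite !mxE.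
    by case: ifP; rewrite ?mulrNN mulr1.
  have : (P *m H) *m (P^T *m diag_mx d) = 1%:M by rewrite mulmxA E.
  move=> /mulmx1C E1.
  have E2 : P^T *m diag_mx d *m P *m H = 1%:M by rewrite -E1 mulmxA.
  by rewrite -[LHS](mulmxK Hu) E2 mul1mx.
pose e : 'rV[R]_n := \row_i (lam 0 i * d 0 i * lam 0 i + lam 0 i).
have Ee : P *m (B *m invmx H *m B + B) *m P^T = diag_mx e.
  rewrite mulmxDr mulmxDl PB -Hi.
  have -> : P *m (B *m (P^T *m diag_mx d *m P) *m B) *m P^T =
    (P *m B *m P^T) *m diag_mx d *m (P *m B *m P^T) by rewrite !mulmxA.
  rewrite PB !mulmx_diag; apply/matrixP => i j; rewrite !mxE.
  by rewrite -mulrnDl.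
move=> E0; exists (n%:R * (4 * `|E0| + 1) * `|P *m B|) => v Ev.
have [w vE] : exists w, v = w *m P by exists (v *m invmx P); rewrite mulmxKV.
have wE : (w *m diag_mx e *m w^T) 0 0 = E0.
  rewrite -Ev -Ee vE; move: (_ + B) => X.
  suff -> : w *m P *m X *m (w *m P)^T = w *m (P *m X *m P^T) *m w^T by [].
  by rewrite trmx_mul !mulmxA.
have wB : `|w| <= 4 * `|E0| + 1.
  apply: (@quadratic_diag_bound n w e sg E0) wE => [|i].
    by rewrite /sg; case: ifP; [left|right].
  (* The entries times [sg] are 1/4, 3/4 or 2; the two remaining cases have contradictory
     indices. *)
  rewrite !mxE /sg; case: (leqP q r) => qr; case: (ltnP i r) => ir; case: (ltnP i q) => iq;
    try lra.
  - by have := leq_trans iq (leq_trans qr ir); rewrite ltnn.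
  - by have := leq_trans (leq_trans qr iq) (ltnW ir); rewrite ltnn.
rewrite vE -mulmxA (le_trans (mulmx_norm _ _))//.
by rewrite ler_wpM2r// ler_wpM2l.
Qed.

End Sylvester.

Theorem theorem1p1 (R : realType) (n : nat) (G : lieGroupType R n)
    (h : pseudo_metric G) (h_bi : bi_invariant h)
    (r s : nat) (rs : (r + s)%N = n) :
  exists g : pseudo_metric G,
    [/\ left_invariant g, geodesically_complete g & metric_signature g r s].
Proof.
have [c0 ac0 c01] := atlas_cover (1%g : G).
have [B [B_sym B_unit B_sig B_def]] :=
  definite_form (gmx_sym h ac0 c01) (gmx_nondegenerate h ac0 c01) rs.
exists (lmetric h_bi ac0 c01 B_sym B_unit); split.
- exact: lmetric_left_invariant.
- exact: lmetric_complete.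
move=> c p ac cp; split=> //; have [_ [P Pu E]] := B_sig.
(* The orthonormal basis for [B] at the unit, carried to [p] by left translation. *)
exists (P *m ltrans c0 c p).
  by rewrite unitmx_mul Pu (ltrans_unit h_bi ac0 c01 ac cp).
apply: etrans E; rewrite trmx_mul.
rewrite -[gmx _ c p]/(lmetric_mx h c0 B c p).
move: (lmetric_mxE h_bi ac0 c01 B ac cp).
by move: (lmetric_mx _ _ _ _ _) (ltrans _ _ _) => X L <-; rewrite !mulmxA.
Qed.
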